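(* Let $\mathbf n=(n_1,\ldots,n_k)\in\mathbb N^k$ with $n_i\ge2$ for all $i$. If $\mathbf T\in\mathbf B_{\mathbf n}(\mathcal H)$ has finite rank defect, then $$0\le\mathrm{curv}(\mathbf T)\le\chi(\mathbf T)\le\mathrm{rank}[\mathbf\Delta_{\mathbf T}(I)].$$
   Context: All Hilbert spaces are complex. $B(\mathcal H)^{n_1}\times_c\cdots\times_cB(\mathcal H)^{n_k}$ is the set of tuples $\mathbf X=(X_1,\ldots,X_k)$, $X_i=(X_{i,1},\ldots,X_{i,n_i})\in B(\mathcal H)^{n_i}$, such that every entry of $X_s$ commutes with every entry of $X_t$ for $s\ne t$ (entries of one $X_i$ need not commute). $\Phi_{X_i}(Y):=\sum_{j=1}^{n_i}X_{i,j}YX_{i,j}^*$, and for $\mathbf p\in\{0,1\}^k$, $\mathbf\Delta_{\mathbf X}^{\mathbf p}:=(id-\Phi_{X_1})^{p_1}\circ\cdots\circ(id-\Phi_{X_k})^{p_k}$. The regular polyball $\mathbf B_{\mathbf n}(\mathcal H)$ is the set of such $\mathbf X$ with $\mathbf\Delta_{\mathbf X}^{\mathbf p}(I)\ge0$ for all $\mathbf p\in\{0,1\}^k$. The defect operator is $\mathbf\Delta_{\mathbf X}(I):=(id-\Phi_{X_1})\circ\cdots\circ(id-\Phi_{X_k})(I)$; finite rank defect means this operator has finite rank. $\mathbb F_{n_i}^+$ is the unital free semigroup on generators $g_1^i,\ldots,g_{n_i}^i$ with identity $g_0^i$, $|\alpha|$ denotes word length, $T_{i,\alpha}:=T_{i,j_1}\cdots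 T_{i,j_p}$ for $\alpha=g^i_{j_1}\cdots g^i_{j_p}$, $T_{i,g_0^i}:=I$. For $\mathbf q\in\mathbb Z_+^k$, $M_{\mathbf q}(\mathbf T):=\mathrm{span}\{T_{1,\alpha_1}\cdots T_{k,\alpha_k}h:|\alpha_i|\le q_i,\ h\in\mathbf\Delta_{\mathbf T}(I)(\mathcal H)\}$. The Euler characteristic is $$\chi(\mathbf T):=\lim_{m\to\infty}\frac{\dim M_{\mathbf q^{(m)}}(\mathbf T)}{\prod_{i=1}^k(1+n_i+\cdots+n_i^{q_i^{(m)}})}$$ for any increasing cofinal sequence $\mathbf q^{(m)}$ in $\mathbb Z_+^k$ (the limit exists and is independent of the sequence). $H_{n_i}$ is an $n_i$-dimensional complex Hilbert space with orthonormal basis $e^i_1,\ldots,e^i_{n_i}$; $F^2(H_{n_i})=\mathbb C1\oplus\bigoplus_{p\ge1}H_{n_i}^{\otimes p}$ has orthonormal basis $e^i_\alpha:=e^i_{j_1}\otimes\cdots\otimes e^i_{j_p}$ for $\alpha=g^i_{j_1}\cdots g^i_{j_p}$, $e^i_{g^i_0}:=1$. $P_q^{(i)}$ is the orthogonal projection of $F^2(H_{n_i})$ onto the span of $e^i_\alpha$, $|\alpha|=q$. The Berezin kernel $\mathbf K_{\mathbf T}:\mathcal H\to F^2(H_{n_1})\otimes\cdots\otimes F^2(H_{n_k})\otimes\overline{\mathbf\Delta_{\mathbf T}(I)(\mathcal H)}$ is $\mathbf K_{\mathbf T}h:=\sum_{\beta_i\in\mathbb F_{n_i}^+}e^1_{\beta_1}\otimes\cdots\otimes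 e^k_{\beta_k}\otimes\mathbf\Delta_{\mathbf T}(I)^{1/2}T_{1,\beta_1}^*\cdots T_{k,\beta_k}^*h$. The curvature of $\mathbf T\in\mathbf B_{\mathbf n}(\mathcal H)$ with trace class defect is $$\mathrm{curv}(\mathbf T):=\lim_{m\to\infty}\frac1{\binom{m+k}{k}}\sum_{\substack{q_1,\ldots,q_k\ge0\\ q_1+\cdots+q_k\le m}}\frac{\mathrm{trace}\left[\mathbf K_{\mathbf T}^*(P^{(1)}_{q_1}\otimes\cdots\otimes P^{(k)}_{q_k}\otimes I)\mathbf K_{\mathbf T}\right]}{\mathrm{trace}\left[P^{(1)}_{q_1}\otimes\cdots\otimes P^{(k)}_{q_k}\right]}$$ (this limit is known to exist). *)

(* Defs.v *)
From HB Require Import structures.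
From mathcomp Require Import all_boot all_order all_algebra.
From mathcomp Require Import all_classical all_reals all_analysis.
From mathcomp Require Import complex ring lra.
Set Implicit Arguments. Unset Strict Implicit. Unset Printing Implicit Defensive.
Import Order.TTheory GRing.Theory Num.Theory.
Import numFieldNormedType.Exports.
Local Open Scope classical_set_scope.
Local Open Scope ring_scope.

HB.mixin Record isInnerProduct (R : realType) V & GRing.Lmodule R[i] V := {
  inner : V -> V -> R[i];
  innerP : forall (a : R[i]) (x y z : V),
    inner (a *: x + y) z = a * inner x z + inner y z;
  inner_conj : forall x y : V, inner y x = Num.conj (inner x y);
  inner_gt0 : forall x : V, x != 0 -> 0 < inner x x
}.

#[short(type="innerProductType")]
HB.structure Definition InnerProduct (R : realType) :=
  {V of GRing.Lmodule R[i] V & isInnerProduct R V}.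

HB.mixin Record InnerProduct_isHilbert (R : realType) H
    & CompleteNormedModule R[i] H & isInnerProduct R H := {
  normr_inner : forall x : H, `|x| ^+ 2 = inner x x
}.

#[short(type="hilbertType")]
HB.structure Definition Hilbert (R : realType) :=
  {H of CompleteNormedModule R[i] H & isInnerProduct R H &
        InnerProduct_isHilbert R H}.

Section InnerTheory.
Context {R : realType} {V : innerProductType R}.
Implicit Types (a : R[i]) (x y z : V).

Definition sqnorm x : R := complex.Re (inner x x).

Lemma innerDl x y z : inner (x + y) z = inner x z + inner y z.
Proof. by rewrite -[x in LHS]scale1r innerP mul1r. Qed.

Lemma inner0l x : inner 0 x = 0.
Proof. by apply: (addrI (inner 0 x)); rewrite -innerDl !addr0. Qed.

Lemma innerZl a x y : inner (a *: x) y = a * inner x y.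
Proof. by rewrite -[X in inner X]addr0 innerP inner0l addr0. Qed.

Lemma innerDr x y z : inner x (y + z) = inner x y + inner x z.
Proof. by rewrite inner_conj innerDl rmorphD/= -!inner_conj. Qed.

Lemma innerZr a x y : inner x (a *: y) = Num.conj a * inner x y.
Proof. by rewrite inner_conj innerZl rmorphM/= -inner_conj. Qed.

Lemma innerr_ge0 x : 0 <= inner x x.
Proof.
by have [->|/inner_gt0/ltW//] := eqVneq x 0; rewrite inner0l.
Qed.

Lemma innerrE x : inner x x = (sqnorm x)%:C%C.
Proof.
have := innerr_ge0 x; rewrite /sqnorm; case: (inner x x) => u v.
by rewrite lecE/= => /andP[/eqP-> _].
Qed.

Lemma sqnorm_ge0 x : 0 <= sqnorm x.
Proof. by have := innerr_ge0 x; rewrite innerrE lecR. Qed.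

Lemma sqnormD x y :
  sqnorm (x + y) = sqnorm x + sqnorm y + 2 * complex.Re (inner x y).
Proof.
rewrite /sqnorm innerDl !innerDr [inner y x]inner_conj !raddfD/=.
rewrite (_ : complex.Re (Num.conj _) = complex.Re (inner x y)); last first.
  by case: (inner x y).
lra.
Qed.

Lemma sqnormZ a x : sqnorm (a *: x) = complex.Re (a * Num.conj a) * sqnorm x.
Proof.
rewrite {1}/sqnorm innerZl innerZr mulrA innerrE.
by case: (a * _) => u v /=; rewrite mulr0 subr0.
Qed.

Lemma sqnormN x : sqnorm (- x) = sqnorm x.
Proof. by rewrite -scaleN1r sqnormZ rmorphN1 mulrNN mulr1 mul1r. Qed.

Lemma sqnormD_le x y : sqnorm (x + y) <= 2 * sqnorm x + 2 * sqnorm y.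
Proof.
have := sqnorm_ge0 (x - y); rewrite !sqnormD sqnormN -scaleN1r innerZr.
rewrite rmorphN1 mulN1r raddfN/=; lra.
Qed.

Lemma Re_inner_le x y : `|complex.Re (inner x y)| <= sqnorm x + sqnorm y.
Proof.
have := sqnorm_ge0 (x - y); have := sqnorm_ge0 (x + y).
rewrite !sqnormD sqnormN -scaleN1r innerZr rmorphN1 mulN1r raddfN/=.
have := sqnorm_ge0 x; have := sqnorm_ge0 y.
by move=> ? ? ? ?; rewrite ler_norml; apply/andP; split; lra.
Qed.

Lemma Im_inner_le x y : `|complex.Im (inner x y)| <= sqnorm x + sqnorm y.
Proof.
have := Re_inner_le x ('i%C *: y); rewrite innerZr sqnormZ.
by case: (inner x y) => u v /=; rewrite !(mul0r, mulN1r, mulr1, mul1r, mulrN, opprK, sub0r, add0r, addr0, oppr0).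
Qed.

End InnerTheory.

Section RealSum.
Context {R : realType} {I : choiceType}.
Implicit Types (f g : I -> R).

Definition rsummable f := summable [set: I] (EFin \o f).

(* The sum of an absolutely summable real family, over an arbitrary index set. *)
Definition rsum f : R :=
  fine (\esum_(i in [set: I]) ((EFin \o f)^\+ i)%E) -
  fine (\esum_(i in [set: I]) ((EFin \o f)^\- i)%E).

Lemma rsummable_le f g :
  (forall i, `|f i| <= `|g i|) -> rsummable g -> rsummable f.
Proof.
by move=> fg; apply: le_lt_trans; apply: le_esum => i _ /=; rewrite lee_fin.
Qed.

Lemma rsummableD f g : rsummable f -> rsummable g -> rsummable (f \+ g).
Proof. exact: summableD. Qed.

Lemma rsummableN f : rsummable f -> rsummable (\- f).
Proof. by move=> ?; rewrite /rsummable (_ : _ \o _ = \- (EFin \o f))%E// -summableN. Qed.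

Lemma esumZ c f : 0 <= c ->
  (\esum_(i in [set: I]) (c * f i)%:E = c%:E * \esum_(i in [set: I]) (f i)%:E)%E.
Proof.
move=> c0; rewrite /esum -ereal_supZl//; last first.
  by apply/set0P; exists (\sum_(x \in set0) (f x)%:E)%E; exists set0 => //; split.
congr ereal_sup; rewrite image_comp; apply: eq_imagel => A [fA _] /=.
by rewrite !fsumEFin// -EFinM -mulr_fsumr.
Qed.

Lemma rsummableZ c f : rsummable f -> rsummable (fun i => c * f i).
Proof.
rewrite /rsummable /summable => sf.
under eq_esum do rewrite /= normrM.
by rewrite esumZ//; apply: lte_mul_pinfty => //; exact: esum_ge0.
Qed.

Lemma esum_fin f : (forall i, 0 <= f i) -> rsummable f ->
  (\esum_(i in [set: I]) (f i)%:E)%E \is a fin_num.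
Proof.
move=> f0; rewrite /rsummable summableE; congr (_ \is a _).
by apply: eq_esum => i _; rewrite /= ger0_norm.
Qed.

Lemma rsum_sub f g : (forall i, 0 <= f i) -> (forall i, 0 <= g i) ->
  rsummable f -> rsummable g ->
  rsum (f \- g) = fine (\esum_(i in [set: I]) (f i)%:E) -
                  fine (\esum_(i in [set: I]) (g i)%:E).
Proof.
move=> f0 g0 sf sg.
have sfg := summableB sf sg.
have fp : (\esum_(i in [set: I]) ((EFin \o (f \- g)%R)^\+ i))%E \is a fin_num.
  have := summable_funepos sfg; rewrite summableE; congr (_ \is a _).
  by apply: eq_esum => i _; rewrite gee0_abs.
have fn : (\esum_(i in [set: I]) ((EFin \o (f \- g)%R)^\- i))%E \is a fin_num.
  have := summable_funeneg sfg; rewrite summableE; congr (_ \is a _).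
  by apply: eq_esum => i _; rewrite gee0_abs.
rewrite /rsum -!fineB ?esum_fin//; congr fine.
by apply: (@esumB _ _ setT (EFin \o f) (EFin \o g)) => // i _; rewrite lee_fin.
Qed.

Lemma rsum_decomp f : rsummable f -> exists u v : I -> R,
  [/\ forall i, 0 <= u i, forall i, 0 <= v i, rsummable u, rsummable v
   & f = u \- v].
Proof.
move=> sf; exists (fun i => Num.max (f i) 0), (fun i => Num.max (- f i) 0).
split.
- by move=> i; rewrite le_max lexx orbT.
- by move=> i; rewrite le_max lexx orbT.
- apply: rsummable_le sf => i; case: (lerP (f i) 0) => _ //.
  by rewrite normr0.
- apply: rsummable_le sf => i; case: (lerP (- f i) 0) => _; rewrite ?normrN//.
  by rewrite normr0.
- apply/funext => i /=.
  by case: (lerP (f i) 0) => ?; case: (lerP (- f i) 0) => ?; lra.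
Qed.

Lemma fine_esumD f g : (forall i, 0 <= f i) -> (forall i, 0 <= g i) ->
  rsummable f -> rsummable g ->
  fine (\esum_(i in [set: I]) ((f \+ g)%R i)%:E) =
  fine (\esum_(i in [set: I]) (f i)%:E) + fine (\esum_(i in [set: I]) (g i)%:E).
Proof.
move=> f0 g0 sf sg; rewrite -fineD ?esum_fin//.
by congr fine; rewrite -esumD// => i _; rewrite lee_fin.
Qed.

Lemma rsumD f g : rsummable f -> rsummable g ->
  rsum (f \+ g) = rsum f + rsum g.
Proof.
move=> /rsum_decomp[u [v [u0 v0 su sv ->]]] /rsum_decomp[s [t [s0 t0 ss st ->]]].
rewrite (_ : _ \+ _ = (u \+ s) \- (v \+ t)); last first.
  by apply/funext => i /=; ring.
rewrite !rsum_sub ?fine_esumD//; first by ring.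
- by move=> i /=; rewrite addr_ge0.
- by move=> i /=; rewrite addr_ge0.
- exact: rsummableD.
- exact: rsummableD.
Qed.

Lemma rsumN f : rsummable f -> rsum (\- f) = - rsum f.
Proof.
move=> /rsum_decomp[u [v [u0 v0 su sv ->]]].
rewrite (_ : \- _ = v \- u); last by apply/funext => i /=; ring.
by rewrite !rsum_sub//; ring.
Qed.

Lemma rsumZ c f : rsummable f -> rsum (fun i => c * f i) = c * rsum f.
Proof.
have pos d : 0 <= d -> rsummable f -> rsum (fun i => d * f i) = d * rsum f.
  move=> d0 /rsum_decomp[u [v [u0 v0 su sv ->]]].
  rewrite (_ : (fun _ => _) = (fun i => d * u i) \- (fun i => d * v i)); last first.
    by apply/funext => i /=; ring.
  rewrite !rsum_sub//; last 4 first.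
  - by move=> i; rewrite mulr_ge0.
  - by move=> i; rewrite mulr_ge0.
  - exact: rsummableZ.
  - exact: rsummableZ.
  by rewrite !esumZ// !fineM ?esum_fin//= mulrBr.
have [/pos//|c0 sf] := leP 0 c.
rewrite (_ : (fun _ => _) = \- (fun i => - c * f i)); last first.
  by apply/funext => i /=; ring.
rewrite rsumN ?pos//; [by ring|lra|exact: rsummableZ].
Qed.

Lemma rsum_ge0E f : (forall i, 0 <= f i) -> rsummable f ->
  (rsum f)%:E = (\esum_(i in [set: I]) (f i)%:E)%E.
Proof.
move=> f0 sf; rewrite (_ : f = f \- cst 0); last first.
  by apply/funext => i /=; rewrite subr0.
have s0 : rsummable (cst 0).
  by apply: rsummable_le sf => i; rewrite normr0.
rewrite rsum_sub// [X in _ - fine X]esum1// subr0 fineK ?esum_fin//.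
by apply: eq_esum => i _ /=; rewrite subr0.
Qed.

End RealSum.

Section ComplexSum.
Context {R : realType} {I : choiceType}.
Implicit Types (f g : I -> R[i]).

Definition csummable f :=
  rsummable (fun i => complex.Re (f i)) /\ rsummable (fun i => complex.Im (f i)).

Definition csum f : R[i] :=
  (rsum (fun i => complex.Re (f i)) +i* rsum (fun i => complex.Im (f i)))%C.

Lemma csumP (a : R[i]) f g : csummable f -> csummable g ->
  csum (fun i => a * f i + g i) = a * csum f + csum g.
Proof.
move=> [fr fi] [gr gi]; case: a => a b; rewrite /csum.
rewrite (_ : (fun i => complex.Re _) = (fun i => a * complex.Re (f i)) \+
    (fun i => - b * complex.Im (f i)) \+ (fun i => complex.Re (g i))); last first.
  by apply/funext => i /=; case: (f i) => x y; case: (g i) => z w /=; ring.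
rewrite (_ : (fun i => complex.Im _) = (fun i => a * complex.Im (f i)) \+
    (fun i => b * complex.Re (f i)) \+ (fun i => complex.Im (g i))); last first.
  by apply/funext => i /=; case: (f i) => x y; case: (g i) => z w /=; ring.
rewrite (rsumD (rsummableD (rsummableZ _ fr) (rsummableZ _ fi)) gr).
rewrite (rsumD (rsummableZ _ fr) (rsummableZ _ fi)) (rsumZ _ fr) (rsumZ _ fi).
rewrite (rsumD (rsummableD (rsummableZ _ fi) (rsummableZ _ fr)) gi).
rewrite (rsumD (rsummableZ _ fi) (rsummableZ _ fr)) (rsumZ _ fr) (rsumZ _ fi).
by apply/eqP; rewrite eq_complex/=; apply/andP; split; apply/eqP; ring.
Qed.

Lemma csum_conj f : csummable f ->
  csum (fun i => Num.conj (f i)) = Num.conj (csum f).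
Proof.
move=> [fr fi]; rewrite /csum.
rewrite (_ : (fun i => complex.Re _) = (fun i => complex.Re (f i))); last first.
  by apply/funext => i /=; case: (f i).
rewrite (_ : (fun i => complex.Im _) = \- (fun i => complex.Im (f i))); last first.
  by apply/funext => i /=; case: (f i).
by rewrite rsumN.
Qed.

End ComplexSum.

Section L2.
Context {R : realType} {I : choiceType} {E : innerProductType R}.

Definition square_summable : {pred I -> E} :=
  [pred f : I -> E | (\esum_(i in [set: I]) (sqnorm (f i))%:E < +oo)%E].

Lemma square_summableP (f : I -> E) :
  f \in square_summable <-> rsummable (fun i => sqnorm (f i)).
Proof.
rewrite inE /rsummable /summable/=; split; apply: le_lt_trans;
  apply: le_esum => i _; by rewrite /= lee_fin ger0_norm ?sqnorm_ge0.
Qed.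

Lemma square_summable_submod_closed : submod_closed square_summable.
Proof.
split=> [|a f g /square_summableP sf /square_summableP sg]; apply/square_summableP.
  rewrite /rsummable /summable esum1// => i _ /=.
  by rewrite /sqnorm inner0l normr0.
have := rsummableD (rsummableZ (2 * complex.Re (a * Num.conj a)) sf)
                   (rsummableZ 2 sg).
apply: rsummable_le => i /=; rewrite ger0_norm ?sqnorm_ge0//.
apply: le_trans (ler_norm _).
by rewrite (le_trans (sqnormD_le _ _))// sqnormZ mulrA.
Qed.

HB.instance Definition _ := GRing.isSubmodClosed.Build _ _ square_summable
  square_summable_submod_closed.

Record l2 := L2 { l2_fun :> I -> E; _ : l2_fun \in square_summable }.

HB.instance Definition _ := [isSub for l2_fun].
HB.instance Definition _ := [Choice of l2 by <:].
HB.instance Definition _ := [SubChoice_isSubLmodule of l2 by <:].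

Implicit Types f g h : l2.

Definition l2_inner f g : R[i] := csum (fun i => inner (f i) (g i)).

Lemma l2_rsummable f : rsummable (fun i => sqnorm (f i)).
Proof. by apply/square_summableP; exact: valP. Qed.

Lemma l2_csummable f g : csummable (fun i => inner (f i) (g i)).
Proof.
have s := rsummableD (l2_rsummable f) (l2_rsummable g).
split; apply: rsummable_le s => i /=; apply: le_trans (ler_norm _).
  exact: Re_inner_le.
exact: Im_inner_le.
Qed.

Let l2_innerP a f g h :
  l2_inner (a *: f + g) h = a * l2_inner f h + l2_inner g h.
Proof.
rewrite /l2_inner -csumP//; try exact: l2_csummable.
by congr csum; apply/funext => i; rewrite -innerP.
Qed.

Let l2_inner_conj f g : l2_inner g f = Num.conj (l2_inner f g).
Proof.
rewrite /l2_inner -csum_conj; last exact: l2_csummable.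
by congr csum; apply/funext => i; rewrite inner_conj.
Qed.

Let l2_inner_gt0 f : f != 0 -> 0 < l2_inner f f.
Proof.
move=> f0; have [i fi0] : exists i, f i != 0.
  apply: contrapT => /forallNP fi0; move/eqP: f0; apply; apply/val_inj/funext => i.
  by apply/eqP/negPn/negP; exact: fi0.
have -> : l2_inner f f = (rsum (fun i => sqnorm (f i)))%:C%C.
  rewrite /l2_inner /csum; congr Complex.
  rewrite (_ : (fun _ => _) = cst 0); last by apply/funext => j; rewrite innerrE.
  apply/EFin_inj; rewrite rsum_ge0E ?esum1//.
  by rewrite /rsummable /summable esum1// => j _ /=; rewrite normr0.
rewrite ltcR -lte_fin rsum_ge0E ?l2_rsummable//; last first.
  by move=> j; exact: sqnorm_ge0.
have : (0 < (sqnorm (f i))%:E)%E.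
  by rewrite lte_fin; have := inner_gt0 _ fi0; rewrite innerrE ltcR.
move=> /lt_le_trans; apply; apply: esum_ge; exists [set i].
  by split=> //; exact: finite_set1.
by rewrite fsbig_set1.
Qed.

HB.instance Definition _ :=
  isInnerProduct.Build R l2 l2_innerP l2_inner_conj l2_inner_gt0.

End L2.
Arguments l2 {R} I E.
Arguments square_summable {R} I E.

Section ScalarField.
Context {R : realType}.
Implicit Types x y z : R[i]^o.

Definition scalar_inner x y : R[i] := (x : R[i]) * Num.conj (y : R[i]).

Let scalar_innerP (a : R[i]) x y z :
  scalar_inner (a *: x + y) z = a * scalar_inner x z + scalar_inner y z.
Proof. by rewrite /scalar_inner mulrDl -mulrA. Qed.

Let scalar_inner_conj x y : scalar_inner y x = Num.conj (scalar_inner x y).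
Proof. by rewrite /scalar_inner rmorphM/= conjCK mulrC. Qed.

Let scalar_inner_gt0 x : x != 0 -> 0 < scalar_inner x x.
Proof. by rewrite /scalar_inner mul_conjC_gt0. Qed.

HB.instance Definition _ := isInnerProduct.Build R R[i]^o
  scalar_innerP scalar_inner_conj scalar_inner_gt0.

End ScalarField.

Section RangeClosure.
Context {R : realType} {V : lmodType R[i]} {H : hilbertType R}.
Variable A : {linear V -> H}.

Definition range_closure_pred : {pred H} := mem (closure (range A)).

Lemma range_closure_submod_closed : submod_closed range_closure_pred.
Proof.
have inP x : x \in range_closure_pred <-> closure (range A) x by split=> [/set_mem|/mem_set].
split=> [|a x y /inP xA /inP yA]; apply/inP.
  by apply: subset_closure; exists 0 => //; rewrite linear0.
move=> B xyB.
have /(_ _ xyB) : (fun z : H * H => a *: z.1 + z.2) @ (x, y) --> a *: x + y.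
  by apply: cvgD; [apply: cvgZr; exact: cvg_fst|exact: cvg_snd].
case=> -[/= B1 B2] [/xA[_ [[u _ <-] B1u]] /yA[_ [[v _ <-] B2v]]] sB.
exists (A (a *: u + v)); split; first by exists (a *: u + v).
by rewrite linearP; exact: (sB (A u, A v)).
Qed.

HB.instance Definition _ := GRing.isSubmodClosed.Build _ _ range_closure_pred
  range_closure_submod_closed.

Record range_closure :=
  RangeClosure { range_closure_val : H; _ : range_closure_val \in range_closure_pred }.

HB.instance Definition _ := [isSub for range_closure_val].
HB.instance Definition _ := [Choice of range_closure by <:].
HB.instance Definition _ := [SubChoice_isSubLmodule of range_closure by <:].

Implicit Types x y z : range_closure.

Definition range_closure_inner x y : R[i] := inner (val x) (val y).

Let range_closure_innerP (a : R[i]) x y z : range_closure_inner (a *: x + y) z =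
  a * range_closure_inner x z + range_closure_inner y z.
Proof. exact: innerP. Qed.

Let range_closure_inner_conj x y :
  range_closure_inner y x = Num.conj (range_closure_inner x y).
Proof. exact: inner_conj. Qed.

Let range_closure_inner_gt0 x : x != 0 -> 0 < range_closure_inner x x.
Proof.
by move=> x0; apply: inner_gt0; apply: contra_neq x0 => x0; exact: val_inj.
Qed.

HB.instance Definition _ := isInnerProduct.Build R range_closure
  range_closure_innerP range_closure_inner_conj range_closure_inner_gt0.

End RangeClosure.
Arguments range_closure {R V H} A.

Section LinearAlgebra.
Context {R : realType} {V : lmodType R[i]}.

Definition lin_span (A : set V) : set V :=
  [set x | exists m (c : 'I_m -> R[i]) (v : 'I_m -> V),
    (forall i, A (v i)) /\ x = \sum_(i < m) c i *: v i].

Definition lin_indep m (v : 'I_m -> V) :=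
  forall c : 'I_m -> R[i], \sum_(i < m) c i *: v i = 0 -> forall i, c i = 0.

Definition has_dim (S : set V) (m : nat) :=
  exists v : 'I_m -> V, lin_indep v /\ lin_span (range v) = S.

(* Zero when [S] is not a finite-dimensional linear subspace. *)
Definition dim (S : set V) : nat := xget 0%N (has_dim S).

End LinearAlgebra.

Definition finite_rank (R : realType) (V W : lmodType R[i]) (A : {linear V -> W}) :=
  exists m, has_dim (range A) m.

Definition rank (R : realType) (V W : lmodType R[i]) (A : {linear V -> W}) : nat :=
  dim (range A).

Section Operators.
Context {R : realType}.

(* The adjoint, where it exists; for a bounded operator on a Hilbert space it
   does, by the Riesz representation theorem. *)
Definition adj {V W : innerProductType R} (f : V -> W) : {linear W -> V} :=
  get (fun g : {linear W -> V} => forall x y, inner (f x) y = inner x (g y)).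

Definition positive_op {V : innerProductType R} (A : V -> V) :=
  forall x, 0 <= inner (A x) x.

(* In a Hilbert space these are the orthonormal bases. *)
Definition orthonormal_basis {V : innerProductType R} (B : set V) :=
  [/\ forall x, B x -> inner x x = 1,
      forall x y, B x -> B y -> x != y -> inner x y = 0
    & forall x, (forall b, B b -> inner x b = 0) -> x = 0].

(* The trace of a positive operator; it does not depend on the basis. *)
Definition trace {V : innerProductType R} (A : V -> V) : \bar R :=
  (\esum_(b in get (@orthonormal_basis V)) (complex.Re (inner (A b) b))%:E)%E.

Definition sqrt_op {H : hilbertType R} (A : {linear H -> H}) : {linear H -> H} :=
  get (fun S : {linear H -> H} =>
    [/\ continuous S, positive_op S & forall x, S (S x) = A x]).

End Operators.

Section CompletelyPositive.
Context {R : realType} {H : hilbertType R}.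

Definition Phi {m} (X : 'I_m -> {linear H -> H}) (Y : {linear H -> H}) (h : H) : H :=
  \sum_(j < m) X j (Y (adj (X j) h)).

Let Phi_linear m (X : 'I_m -> {linear H -> H}) Y : linear (Phi X Y).
Proof.
move=> a x y; rewrite /Phi scaler_sumr -big_split/=.
by apply: eq_bigr => j _; rewrite !linearP.
Qed.

HB.instance Definition _ m (X : 'I_m -> {linear H -> H}) (Y : {linear H -> H}) :=
  GRing.isLinear.Build R[i] H H *:%R (Phi X Y) (@Phi_linear m X Y).

Definition id_sub_Phi {m} (X : 'I_m -> {linear H -> H}) (Y : {linear H -> H}) :
  {linear H -> H} := Y \- Phi X Y.

End CompletelyPositive.

Section Polyball.
Context {R : realType} {H : hilbertType R} {k : nat} {n : 'I_k -> nat}.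
Implicit Types X T : forall i : 'I_k, 'I_(n i) -> {linear H -> H}.

Definition Delta_pow X (p : 'I_k -> bool) : {linear H -> H} -> {linear H -> H} :=
  \big[comp/id]_(i < k) iter (p i) (id_sub_Phi (X i)).

Definition regular_polyball X :=
  [/\ forall i j, continuous (X i j),
      forall s t, s != t -> forall j l h, X s j (X t l h) = X t l (X s j h)
    & forall p : 'I_k -> bool, positive_op (Delta_pow X p idfun)].

Definition defect X : {linear H -> H} :=
  (\big[comp/id]_(i < k) id_sub_Phi (X i)) idfun.

End Polyball.

(* A tuple of words, one in each free semigroup F_{n_i}^+; words are lists of
   letters, the identity g_0 is the empty list. *)
Definition words k (n : 'I_k -> nat) : choiceType := forall i : 'I_k, seq 'I_(n i).

(* [fock n E] is F^2(H_{n_1}) (x) ... (x) F^2(H_{n_k}) (x) E, read in the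
   orthonormal basis of the full Fock spaces indexed by words: the family [f]
   stands for the sum over [b] of e_{b_1} (x) ... (x) e_{b_k} (x) (f b). *)
Definition fock {R : realType} {k} (n : 'I_k -> nat) (E : innerProductType R) :
  innerProductType R := l2 (words n) E.

Section FockProjection.
Context {R : realType} {k : nat} {n : 'I_k -> nat} {E : innerProductType R}.

Lemma restrict_square_summable (q : 'I_k -> nat) (f : fock n E) :
  (fun b : words n => if [forall i, size (b i) == q i] then f b else 0)
    \in square_summable (words n) E.
Proof.
apply/square_summableP; apply: rsummable_le (l2_rsummable f) => b /=.
by case: ifP => // _; rewrite /sqnorm inner0l normr0.
Qed.

(* P_{q_1} (x) ... (x) P_{q_k} (x) I *)
Definition fock_proj (q : 'I_k -> nat) (f : fock n E) : fock n E :=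
  L2 (restrict_square_summable q f).

End FockProjection.

Section Invariants.
Context {R : realType} {H : hilbertType R} {k : nat} {n : 'I_k -> nat}.
Variable T : forall i : 'I_k, 'I_(n i) -> {linear H -> H}.
Implicit Types (b : words n) (q : 'I_k -> nat).

Definition word_op (i : 'I_k) (a : seq 'I_(n i)) : H -> H :=
  \big[comp/id]_(j <- a) (T j : H -> H).

Definition Mspace q : set H :=
  lin_span [set x | exists b h, (forall i, (size (b i) <= q i)%N) /\
    x = (\big[comp/id]_(i < k) word_op (b i)) (defect T h)].

Definition euler_ratio q : R :=
  (dim (Mspace q))%:R / (\prod_(i < k) \sum_(j < (q i).+1) n i ^ j)%N%:R.

Definition cofinal_increasing (q : nat -> 'I_k -> nat) :=
  (forall l m i, (l <= m)%N -> (q l i <= q m i)%N) /\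
  (forall p : 'I_k -> nat, exists m, forall i, (p i <= q m i)%N).

(* The common limit along all increasing cofinal sequences, for which
   "increasing" is meant coordinatewise and weakly. *)
Definition euler_char : R :=
  get (fun x : R => forall q : nat -> 'I_k -> nat, cofinal_increasing q ->
    euler_ratio (q m) @[m --> \oo] --> x).

(* [insubd] injects into l^2 and into the closure of the range of the defect;
   its default values are never used when [T] is in the regular polyball. *)
Definition berezin (h : H) : fock n (range_closure (defect T)) :=
  insubd (0 : l2 (words n) (range_closure (defect T)))
    (fun b => insubd (0 : range_closure (defect T))
      (sqrt_op (defect T)
        ((\big[comp/id]_(i < k) (adj (word_op (b i)) : H -> H)) h))).

Definition curvature_term q : R :=
  fine (trace (adj berezin \o fock_proj q \o berezin)) /
  fine (trace (fock_proj q : fock n R[i]^o -> fock n R[i]^o)).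

Definition curvature : R :=
  lim ((fun m : nat => ('C(m + k, k)%:R)^-1 *
    \sum_(q : {ffun 'I_k -> 'I_m.+1} | (\sum_(i < k) q i <= m)%N)
      curvature_term (fun i => q i)) @ \oo).

End Invariants.

(* Main.v *)
From HB Require Import structures.
Require Import Defs.
From mathcomp Require Import all_boot all_order all_algebra.
From mathcomp Require Import all_classical all_reals all_analysis.
From mathcomp Require Import complex ring lra.
Import Order.TTheory GRing.Theory Num.Theory.
Import numFieldNormedType.Exports.
Local Open Scope classical_set_scope.
Local Open Scope ring_scope.

Set Implicit Arguments.
Unset Strict Implicit.
Unset Printing Implicit Defensive.

(** Let [Delta] be the defect operator of [T], [S] its square root, [r] its rank,
    [u_1, .., u_r] an orthonormal basis of its range, and [T_w] the operator of a
    tuple of words [w]. Everything is expressed through the numbers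
    [mass w = sum_s ||T_w S u_s||^2].

    Parseval's identity, applied in [H] to the numerator and in the Fock space to
    the denominator, turns the [q]-th term of the curvature into the average of
    [mass w] over the words of length exactly [q] ([trace_berezin],
    [trace_fock_proj]). As a word of length [q >= p] is a word of length [p]
    preceded by further letters, and letters act as contractions, these averages
    decrease in [q] ([curvature_term_decreasing]). Their means over large
    simplices therefore converge to their infimum [L >= 0]
    ([simplex_average_cvg]), and the curvature is [L].

    The space [M_q] is spanned by the vectors [T_w u_s] with [w] of length at most
    [q], so that the Euler ratio is at most [r]. A word of length at most [q]
    either factors through a word of length at most [p], or is one of a proportion
    at most [sum_i 2^-p_i] of all words; hence the Euler ratio is decreasing up to
    an error that tends to zero ([euler_ratio_quasi_decreasing]) and converges
    along every cofinal sequence, to a limit which is at most [r].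

    It remains to compare the two. Expanding [T_w S u_s] in an orthonormal basis
    [y_t] of [M_q] shows that the sum of [mass w] over the words of length at most
    [q] is the sum over [t] of the squared norms of truncations of the Berezin
    kernel at [y_t]. The kernel is a contraction: in a regular polyball the partial
    defects interpolate positively between [Delta] and the identity, and summing
    out one index after the other telescopes ([sum_defect_words_le]). The sum of
    masses is therefore at most [dim M_q] ([bounded_mass_le_dim]), while it is at
    least [L] times the number of words ([bounded_mass_ge]); so [L] is at most the
    Euler ratio.

    The operators involved are given by choice, so their existence is part of the
    argument: adjoints come from the Riesz representation theorem, square roots
    from the spectral theorem for Hermitian matrices, orthonormal bases from
    Zorn's lemma, and Parseval's identity for the Fock space from its
    completeness. *)
(** * Spans and dimensions *)

Section Dimension.
Context {R : realType} {V : lmodType R[i]}.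
Implicit Types (A B : set V).

Lemma lin_spanP (J : finType) (w : J -> V) x :
  lin_span (range w) x <-> exists c : J -> R[i], x = \sum_j c j *: w j.
Proof.
split=> [[m [c [v [vw ->]]]]|[c ->]].
  have /choice[f fP] i : exists j, w j = v i by have [j _ <-] := vw i; exists j.
  exists (fun j => \sum_(i | f i == j) c i).
  under [RHS]eq_bigr do rewrite scaler_suml.
  rewrite (exchange_big_dep xpredT)//=; apply: eq_bigr => i _.
  rewrite (big_pred1 (f i)) ?fP// => j; exact: eq_sym.
exists #|J|, (fun i => c (enum_val i)), (fun i => w (enum_val i)).
split; first by move=> i; exists (enum_val i).
by rewrite (reindex (@enum_val J predT))//; apply: onW_bij; exact: enum_val_bij.
Qed.

(** With more independent vectors than elements of the family, the matrix of
    coefficients has a nonzero left kernel, which is a linear relation. *)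
Lemma steinitz m (J : finType) (v : 'I_m -> V) (w : J -> V) :
  lin_indep v -> (forall i, lin_span (range w) (v i)) -> (m <= #|J|)%N.
Proof.
move=> iv vw; have /choice[c cE] i := (lin_spanP w (v i)).1 (vw i).
rewrite leqNgt; apply/negP => Jm.
pose M : 'M[R[i]]_(m, #|J|) := \matrix_(i, j) c i (enum_val j).
have : kermx M != 0.
  rewrite kermx_eq0 -row_leq_rank -ltnNge.
  exact: leq_ltn_trans (rank_leq_col M) Jm.
case/rowV0Pn=> a /sub_kermxP aM; apply/negP; rewrite negbK.
apply/eqP/rowP => i; rewrite mxE.
apply: iv i; under eq_bigr do rewrite cE scaler_sumr.
rewrite exchange_big big1//= => j _.
under eq_bigr do rewrite scalerA; rewrite -scaler_suml.
have /rowP/(_ (enum_rank j)) := aM.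
rewrite !mxE (eq_bigr (fun i => a 0 i * c i j)); first by move=> ->; rewrite scale0r.
by move=> i _; rewrite mxE enum_rankK.
Qed.

Lemma lin_span_submod B : lin_span B 0 /\
  forall a x y, lin_span B x -> lin_span B y -> lin_span B (a *: x + y).
Proof.
split.
  exists 0%N, (fun=> 0), (fun=> 0); split; first by case.
  by rewrite big_ord0.
move=> a _ _ [m [c [v [vB ->]]]] [n [d [w [wB ->]]]].
exists (m + n)%N.
exists (fun i => match fintype.split i with inl j => a * c j | inr j => d j end).
exists (fun i => match fintype.split i with inl j => v j | inr j => w j end).
split; first by move=> i; case: fintype.split.
rewrite big_split_ord/= scaler_sumr; congr (_ + _); apply: eq_bigr => i _.
  by rewrite scalerA (unsplitK (inl i)).
by rewrite (unsplitK (inr i)).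
Qed.

Lemma lin_span_sub B x : B x -> lin_span B x.
Proof.
move=> Bx; exists 1%N, (fun=> 1), (fun=> x); split => //.
by rewrite big_ord1 scale1r.
Qed.

Lemma lin_span_sum B (I : Type) (r : seq I) (P : pred I) (c : I -> R[i]) (v : I -> V) :
  (forall i, P i -> lin_span B (v i)) ->
  lin_span B (\sum_(i <- r | P i) c i *: v i).
Proof.
move=> vB; have [B0 Blin] := lin_span_submod B.
by elim/big_rec: _ => // i x Pi Bx; apply: Blin => //; exact: vB.
Qed.

Lemma lin_span_min A B : A `<=` lin_span B -> lin_span A `<=` lin_span B.
Proof.
by move=> AB x [m [c [v [vA ->]]]]; apply: lin_span_sum => i _; exact/AB/vA.
Qed.

Lemma has_dim_uniq A m n : has_dim A m -> has_dim A n -> m = n.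
Proof.
have le p q : has_dim A p -> has_dim A q -> (p <= q)%N.
  move=> [v [iv vA]] [w [_ wA]]; rewrite -[q]card_ord.
  apply: (steinitz iv (w := w)) => i.
  by rewrite wA -vA; apply: lin_span_sub; exists i.
by move=> Am An; apply/eqP; rewrite eqn_leq !le.
Qed.

Lemma dimE A m : has_dim A m -> Defs.dim A = m.
Proof. by move=> Am; apply: has_dim_uniq (Am); exact: xgetPex (ex_intro _ m Am). Qed.

End Dimension.

(** * Inner products and finite orthonormal families *)

Section SquaredModulus.
Context {R : realType}.
Implicit Types (c d : R[i]).

Definition sqmod c : R := complex.Re c ^+ 2 + complex.Im c ^+ 2.

Lemma mul_conj_sqmod c : c * Num.conj c = (sqmod c)%:C%C.
Proof. by rewrite /sqmod add_Re2_Im2 -normCK. Qed.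

Lemma Re_mul_conj c : complex.Re (c * Num.conj c) = sqmod c.
Proof. by rewrite mul_conj_sqmod. Qed.

Lemma sqmod_ge0 c : 0 <= sqmod c.
Proof. by rewrite /sqmod addr_ge0 ?sqr_ge0. Qed.

Lemma sqmod_eq0 c : sqmod c = 0 -> c = 0.
Proof.
case: c => a b; rewrite /sqmod /= => /eqP.
by rewrite paddr_eq0 ?sqr_ge0// !sqrf_eq0 => /andP[/eqP-> /eqP->].
Qed.

Lemma sqmod0 : sqmod 0 = 0.
Proof. by rewrite /sqmod /= expr0n addr0. Qed.

Lemma sqmodM c d : sqmod (c * d) = sqmod c * sqmod d.
Proof. by case: c d => [a b] [a' b']; rewrite /sqmod/=; ring. Qed.

Lemma sqmod_conj c : sqmod (Num.conj c) = sqmod c.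
Proof. by case: c => [a b]; rewrite /sqmod/= sqrrN. Qed.

Lemma sqmod_real (r : R) : sqmod r%:C%C = r ^+ 2.
Proof. by rewrite /sqmod /= expr0n addr0. Qed.

Lemma Re_sum (I : Type) (r : seq I) (P : pred I) (F : I -> R[i]) :
  complex.Re (\sum_(i <- r | P i) F i) = \sum_(i <- r | P i) complex.Re (F i).
Proof. by elim/big_rec2: _ => // i x y _ <-; rewrite raddfD. Qed.

Lemma Re_realM (r : R) c : complex.Re (r%:C%C * c) = r * complex.Re c.
Proof. by case: c => a b /=; ring. Qed.

Lemma conj_real_complex (r : R) : Num.conj (r%:C%C : R[i]) = r%:C%C.
Proof. exact: conjc_real. Qed.

Lemma Re_conj c : complex.Re (Num.conj c) = complex.Re c.
Proof. by case: c. Qed.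

End SquaredModulus.

Section InnerBasics.
Context {R : realType} {V : innerProductType R}.
Implicit Types (a : R[i]) (x y z : V).

Lemma inner0r x : inner x 0 = 0.
Proof. by rewrite inner_conj inner0l rmorph0. Qed.

Lemma innerNl x y : inner (- x) y = - inner x y.
Proof. by rewrite -scaleN1r innerZl mulN1r. Qed.

Lemma innerNr x y : inner x (- y) = - inner x y.
Proof. by rewrite -scaleN1r innerZr rmorphN1 mulN1r. Qed.

Lemma innerBl x y z : inner (x - y) z = inner x z - inner y z.
Proof. by rewrite innerDl innerNl. Qed.

Lemma innerBr x y z : inner x (y - z) = inner x y - inner x z.
Proof. by rewrite innerDr innerNr. Qed.

Lemma inner_suml (I : Type) (r : seq I) (P : pred I) (F : I -> V) y :
  inner (\sum_(i <- r | P i) F i) y = \sum_(i <- r | P i) inner (F i) y.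
Proof.
elim/big_rec2: _ => [|i u v _ <-]; first exact: inner0l.
by rewrite innerDl.
Qed.

Lemma inner_sumr (I : Type) (r : seq I) (P : pred I) (F : I -> V) y :
  inner y (\sum_(i <- r | P i) F i) = \sum_(i <- r | P i) inner y (F i).
Proof.
elim/big_rec2: _ => [|i u v _ <-]; first exact: inner0r.
by rewrite innerDr.
Qed.

Lemma sqnorm0 : sqnorm (0 : V) = 0.
Proof. by rewrite /sqnorm inner0l. Qed.

Lemma sqnorm_eq0 x : sqnorm x = 0 -> x = 0.
Proof.
move=> x0; apply/eqP/negPn/negP => /inner_gt0.
by rewrite innerrE x0 ltxx.
Qed.

Lemma sqnormZ_sqmod a x : sqnorm (a *: x) = sqmod a * sqnorm x.
Proof. by rewrite sqnormZ Re_mul_conj. Qed.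

Lemma sqnormB x y :
  sqnorm (x - y) = sqnorm x + sqnorm y - 2 * complex.Re (inner x y).
Proof. by rewrite sqnormD sqnormN innerNr raddfN /= mulrN. Qed.

Lemma sqnorm_subC x y : sqnorm (x - y) = sqnorm (y - x).
Proof. by rewrite -sqnormN opprB. Qed.

Lemma sqnorm_trans_le x y z :
  sqnorm (x - z) <= 2 * sqnorm (x - y) + 2 * sqnorm (y - z).
Proof. by have := sqnormD_le (x - y) (y - z); rewrite addrA subrK. Qed.

Lemma inner_extl x y : (forall z, inner x z = inner y z) -> x = y.
Proof.
move=> xy; apply/eqP; rewrite -subr_eq0; apply/eqP/sqnorm_eq0.
by rewrite /sqnorm innerBl xy subrr.
Qed.

Lemma inner_extr x y : (forall z, inner z x = inner z y) -> x = y.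
Proof. by move=> xy; apply: inner_extl => z; rewrite inner_conj xy -inner_conj. Qed.

Lemma Cauchy_Schwarz x y : sqmod (inner x y) <= sqnorm x * sqnorm y.
Proof.
have [->|y0] := eqVneq y 0; first by rewrite inner0r sqmod0 sqnorm0 mulr0.
have ny : 0 < sqnorm y by rewrite -ltcR -innerrE inner_gt0.
have := sqnorm_ge0 ((sqnorm y)%:C%C *: x - inner x y *: y).
rewrite sqnormB !sqnormZ_sqmod sqmod_real innerZl innerZr Re_realM.
rewrite [_ * inner x y]mulrC mul_conj_sqmod /=.
set N := sqnorm y in ny *; set M := sqnorm x; set c := sqmod _ => h.
have : 0 <= N * (M * N - c) by apply: le_trans h _; lra.
by rewrite pmulr_rge0// subr_ge0.
Qed.

(** Unlike the Cauchy-Schwarz inequality this bound is linear in the squared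
    norms, which suits the limit arguments below. *)
Lemma Re_inner_young x y : 2 * complex.Re (inner x y) <= sqnorm x + sqnorm y.
Proof. by have := sqnorm_ge0 (x - y); rewrite sqnormB; lra. Qed.

End InnerBasics.

Section Orthonormal.
Context {R : realType} {V : innerProductType R} {I : finType}.
Implicit Types (x : V) (u : I -> V) (c : I -> R[i]).

Definition orthonormal u := forall i j, inner (u i) (u j) = (i == j)%:R.

Lemma inner_orthonormal_sum u c j : orthonormal u ->
  inner (\sum_i c i *: u i) (u j) = c j.
Proof.
move=> ou; rewrite inner_suml (bigD1 j)//= innerZl ou eqxx mulr1.
rewrite big1 ?addr0// => i ij.
by rewrite innerZl ou (negPf ij) mulr0.
Qed.

Lemma sqnorm_orthonormal_sum u c : orthonormal u ->
  sqnorm (\sum_i c i *: u i) = \sum_i sqmod (c i).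
Proof.
move=> ou; rewrite /sqnorm inner_sumr Re_sum; apply: eq_bigr => i _.
by rewrite innerZr inner_orthonormal_sum// mulrC Re_mul_conj.
Qed.

(** Pythagoras: the error of an approximation of [x] in the span of [u] splits
    into the distance from [x] to that span and the error in the Fourier
    coefficients. Bessel's inequality and the optimality of the Fourier
    coefficients are both read off from it. *)
Lemma sqnorm_sub_orthonormal u c x : orthonormal u ->
  sqnorm (x - \sum_i c i *: u i) =
  sqnorm x - \sum_i sqmod (inner x (u i)) + \sum_i sqmod (inner x (u i) - c i).
Proof.
move=> ou; rewrite sqnormB sqnorm_orthonormal_sum// inner_sumr Re_sum.
rewrite mulr_sumr -!addrA; congr (_ + _).
rewrite addrC -!sumrN -!big_split/=; apply: eq_bigr => i _.
rewrite innerZr /sqmod; case: (inner x (u i)) (c i) => [a b] [a' b'] /=; ring.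
Qed.

Lemma bessel u x : orthonormal u ->
  \sum_i sqmod (inner x (u i)) <= sqnorm x.
Proof.
move=> ou.
have := sqnorm_ge0 (x - \sum_i inner x (u i) *: u i).
rewrite sqnorm_sub_orthonormal// [X in _ + X]big1 ?addr0 ?subr_ge0// => i _.
by rewrite subrr sqmod0.
Qed.

Lemma orthonormal_expand u c x : orthonormal u -> x = \sum_i c i *: u i ->
  x = \sum_i inner x (u i) *: u i.
Proof.
move=> ou xE; rewrite {1}xE; apply: eq_bigr => i _.
by rewrite xE inner_orthonormal_sum.
Qed.

Lemma parseval_finite u c x : orthonormal u -> x = \sum_i c i *: u i ->
  sqnorm x = \sum_i sqmod (inner x (u i)).
Proof.
move=> ou /(orthonormal_expand ou) xE.
by rewrite {1}xE sqnorm_orthonormal_sum.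
Qed.

End Orthonormal.

(** * Complete inner product spaces: projections, Riesz, Parseval *)

Section CompleteSpaces.
Context {R : realType} {V : innerProductType R}.
Implicit Types (x y z : V) (u : nat -> V).

Definition sq_cvg u x :=
  forall e : R, 0 < e -> exists N, forall m, (N <= m)%N -> sqnorm (u m - x) < e.

Definition sq_cauchy u :=
  forall e : R, 0 < e -> exists N, forall m n, (N <= m)%N -> (N <= n)%N ->
    sqnorm (u m - u n) < e.

End CompleteSpaces.

(** Completeness phrased through the squared norm, so that it makes sense for
    an inner product space that carries no topology, such as the Fock spaces. *)
Definition sq_complete (R : realType) (V : innerProductType R) :=
  forall u : nat -> V, sq_cauchy u -> exists x, sq_cvg u x.

Lemma natSinv_lt (R : realType) (e : R) : 0 < e ->
  exists N, forall n, (N <= n)%N -> n.+1%:R^-1 < e.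
Proof.
move=> e0; have [N _ hN] := near_infty_natSinv_lt (PosNum e0).
by exists N => n; exact: hN.
Qed.

Section Projection.
Context {R : realType} {V : innerProductType R}.
Hypothesis V_complete : sq_complete V.
Variable M : set V.
Hypotheses (M0 : M 0) (Mlin : forall a x y, M x -> M y -> M (a *: x + y)).

Let MD x y : M x -> M y -> M (x + y).
Proof. by move=> Mx My; rewrite -[x]scale1r; exact: Mlin. Qed.

Let MZ a x : M x -> M (a *: x).
Proof. by move=> Mx; rewrite -[_ *: _]addr0; exact: Mlin. Qed.

(** A sequence in [M] minimising the distance to [x] is Cauchy by the
    parallelogram identity, because midpoints stay in [M]; its limit is the
    projection, as moving along [M] can no longer decrease the distance. *)
Lemma projection_closure (x : V) : exists z : V,
  (forall e : R, 0 < e -> exists2 m, M m & sqnorm (z - m) < e) /\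
  forall m, M m -> inner (x - z) m = 0.
Proof.
pose D := [set sqnorm (x - m) | m in M]; pose d := inf D.
have infD : has_inf D.
  split; first by exists (sqnorm (x - 0)), 0.
  by exists 0 => _ [m _ <-]; exact: sqnorm_ge0.
have dle m : M m -> d <= sqnorm (x - m).
  by move=> Mm; apply: ge_inf; [exact: infD.2|exists m].
have /choice[u uP] n : exists m, M m /\ sqnorm (x - m) < d + n.+1%:R^-1.
  have n0 : (0 : R) < n.+1%:R^-1 by rewrite invr_gt0.
  by have [_ [m Mm <-] ?] := inf_adherent n0 infD; exists m.
have Mu n := (uP n).1; have lu n := (uP n).2.
have parallel m n :
    sqnorm (u m - u n) <= 2 * m.+1%:R^-1 + 2 * n.+1%:R^-1.
  pose p := x - u m; pose q := x - u n.
  have -> : u m - u n = q - p by rewrite /p /q opprB [RHS]addrC addrA subrK.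
  have mid : sqnorm (q + p) = 4 * sqnorm (x - 2^-1 *: (u m + u n)).
    have -> : q + p = 2 *: (x - 2^-1 *: (u m + u n)).
      rewrite scalerBr scalerA divff ?pnatr_eq0// scale1r scaler_nat mulr2n.
      by rewrite /p /q addrACA opprD [- u m - u n]addrC.
    rewrite sqnormZ_sqmod; congr (_ * _).
    by rewrite /sqmod /=; ring.
  have := dle _ (MZ 2^-1 (MD (Mu m) (Mu n))).
  have := lu m; have := lu n; rewrite -/p -/q.
  move: mid; rewrite sqnormD [sqnorm (q - p)]sqnormB.
  by move: (m.+1%:R^-1) (n.+1%:R^-1) (sqnorm (x - 2^-1 *: _)) => ? ? ?; lra.
have /V_complete[z uz] : sq_cauchy u.
  move=> e e0; have e4 : 0 < e / 4 by rewrite divr_gt0.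
  have [N hN] := natSinv_lt e4; exists N => m n Nm Nn.
  apply: le_lt_trans (parallel m n) _.
  move: (hN m Nm) (hN n Nn).
  by move: (m.+1%:R^-1) (n.+1%:R^-1) => ? ?; lra.
exists z; split.
  move=> e e0; have [N hN] := uz e e0; exists (u N); first exact: Mu.
  by rewrite sqnorm_subC; exact: hN.
have first_order (s : R) m : M m ->
    2 * s * complex.Re (inner (x - z) m) <= 2 * s ^+ 2 * sqnorm m.
  move=> Mm; apply/ler_addgt0Pr => e e0.
  have e2 : 0 < e / 2 by rewrite divr_gt0.
  have [N1 h1] := natSinv_lt e2; have [N2 h2] := uz _ e2.
  pose n := maxn N1 N2; have := h1 n (leq_maxl _ _).
  have := h2 n (leq_maxr _ _).
  have sM : M (s%:C%C *: m) by exact: MZ.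
  have far := dle _ (MD (Mu n) sM); rewrite opprD addrA in far.
  move: far (Re_inner_young (u n - z) (s%:C%C *: m)) (lu n).
  have -> : inner (x - z) m = inner (x - u n) m + inner (u n - z) m.
    by rewrite -innerDl addrA subrK.
  rewrite [sqnorm (x - u n - _)]sqnormB !innerZr !sqnormZ_sqmod sqmod_real.
  rewrite !conj_real_complex !Re_realM raddfD/=.
  by move: (n.+1%:R^-1) => ?; lra.
have Re0 m : M m -> complex.Re (inner (x - z) m) = 0.
  move=> Mm; set r := complex.Re _; pose c := sqnorm m + 1.
  have c0 : 0 < c by rewrite ltr_wpDl ?sqnorm_ge0.
  (* the value of the step length that makes the first-order term dominate *)
  have := first_order (r / c) m Mm; rewrite -/r.
  have -> : sqnorm m = c - 1 by rewrite /c addrK.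
  rewrite -(ler_pM2r (exprn_gt0 2 c0)).
  have -> : 2 * (r / c) * r * c ^+ 2 = 2 * r ^+ 2 * c by field; exact: lt0r_neq0.
  have -> : 2 * (r / c) ^+ 2 * (c - 1) * c ^+ 2 = 2 * r ^+ 2 * (c - 1).
    by field; exact: lt0r_neq0.
  move=> h; apply/eqP; rewrite -sqrf_eq0 eq_le sqr_ge0 andbT; lra.
move=> m Mm; have := Re0 m Mm; have := Re0 ('i%C *: m) (MZ _ Mm).
rewrite innerZr; case: (inner (x - z) m) => a b /=.
by rewrite mul0r mulN1r opprK add0r => -> ->.
Qed.

End Projection.

Section Riesz.
Context {R : realType} {V : innerProductType R}.
Hypothesis V_complete : sq_complete V.

(** For a nonzero functional the representing vector spans the orthogonal
    complement of the kernel. *)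
Lemma riesz_representation (phi : V -> R[i]) (C : R) :
  (forall a x y, phi (a *: x + y) = a * phi x + phi y) ->
  (forall x, sqmod (phi x) <= C * sqnorm x) ->
  exists w, forall x, phi x = inner x w.
Proof.
move=> philin phiC.
have phi0 : phi 0 = 0.
  by apply: sqmod_eq0; apply/le_anti; rewrite sqmod_ge0 (le_trans (phiC 0))//
    sqnorm0 mulr0.
have [phi_eq0|/existsNP[x0 /eqP x0P]] := pselect (forall x, phi x = 0).
  by exists 0 => x; rewrite inner0r phi_eq0.
pose M := [set x | phi x = 0].
have Mlin a x y : M x -> M y -> M (a *: x + y).
  by rewrite /M /= philin => -> ->; rewrite mulr0 addr0.
have [z [Mz zM]] := projection_closure V_complete phi0 Mlin x0.
have phiB x y : phi (x - y) = phi x - phi y.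
  by rewrite addrC -scaleN1r philin mulN1r addrC.
have phiz : phi z = 0.
  apply: sqmod_eq0; apply/le_anti; rewrite sqmod_ge0 andbT.
  apply/ler_addgt0Pr => e e0; rewrite add0r.
  have C1 : 0 < `|C| + 1 by rewrite ltr_wpDl.
  have [m Mm zm] := Mz (e / (`|C| + 1)) (divr_gt0 e0 C1).
  have -> : phi z = phi (z - m) by rewrite phiB Mm subr0.
  apply: le_trans (phiC _) _; rewrite ltr_pdivlMr// in zm.
  apply: le_trans _ (ltW zm); rewrite mulrC ler_wpM2l ?sqnorm_ge0//.
  by rewrite (le_trans (ler_norm _))// lerDl.
pose g := x0 - z; have phig : phi g != 0 by rewrite /g phiB phiz subr0.
have g0 : inner g g != 0.
  apply: contra phig => /eqP gg; suff -> : g = 0 by rewrite phi0.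
  by apply: sqnorm_eq0; rewrite /sqnorm gg.
exists (Num.conj (phi g / inner g g) *: g) => x.
rewrite innerZr conjCK.
have /zM : M (- (phi x / phi g) *: g + x).
  by rewrite /M /= philin mulNr divfK// addNr.
rewrite -/g inner_conj innerDl innerZl => /eqP.
rewrite conjC_eq0 mulNr addrC subr_eq0 => /eqP->.
by field; apply/andP.
Qed.

(** The Riesz theorem shows that the choice made in [adj] is not vacuous. *)
Lemma adjP (W : innerProductType R) (f : V -> W) (C : R) :
  (forall a x y, f (a *: x + y) = a *: f x + f y) ->
  (forall x, sqnorm (f x) <= C * sqnorm x) ->
  forall x y, inner (f x) y = inner x (adj f y).
Proof.
move=> flin fC; rewrite /adj; apply: (@getPex _ [set g : {linear W -> V} |
  forall x y, inner (f x) y = inner x (g y)]).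
have /choice[g gP] y : exists w, forall x, inner (f x) y = inner x w.
  apply: (@riesz_representation _ (C * sqnorm y)) => [a x1 x2|x].
    by rewrite flin innerP.
  apply: le_trans (Cauchy_Schwarz _ _) _.
  by rewrite mulrAC ler_wpM2r ?sqnorm_ge0.
have glin : linear g.
  move=> a x y; apply: inner_extr => z.
  by rewrite -gP innerDr innerZr innerDr innerZr !gP.
pose G : {linear W -> V} := HB.pack g (GRing.isLinear.Build R[i] W V *:%R g glin).
by exists G.
Qed.

End Riesz.

Section OrthonormalBasis.
Context {R : realType} {V : innerProductType R}.
Implicit Types (B : set V) (x : V) (s : seq V).

(** A maximal orthonormal set, given by Zorn's lemma, has no nonzero vector
    orthogonal to it: such a vector could be normalised and added. *)
Lemma orthonormal_basis_exists : exists B, orthonormal_basis B.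
Proof.
pose P B := (forall x, B x -> inner x x = 1) /\
  (forall x y, B x -> B y -> x != y -> inner x y = 0).
have [] := @Zorn_bigcup V P.
  move=> F FP Ftot; split=> [x [B FB Bx]|x y [B FB Bx] [C FC Cy]].
    exact: (FP _ FB).1.
  have [BC|CB] := Ftot _ _ FB FC; first exact: (FP _ FC).2 (BC _ Bx) Cy.
  exact: (FP _ FB).2 Bx (CB _ Cy).
move=> B [[B1 B0] Bmax]; exists B; split=> // x xB.
have [//|x0] := eqVneq x 0; exfalso.
have xx0 : 0 < sqnorm x by rewrite -ltcR -innerrE inner_gt0.
pose y := (Num.sqrt (sqnorm x))^-1%:C%C *: x.
have yB b : B b -> inner y b = 0 by move=> Bb; rewrite innerZl xB ?mulr0.
have By b : B b -> inner b y = 0 by move=> Bb; rewrite inner_conj yB ?rmorph0.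
have y1 : inner y y = 1.
  rewrite innerrE sqnormZ_sqmod sqmod_real exprVn sqr_sqrtr ?(ltW xx0)//.
  by rewrite mulVf ?lt0r_neq0.
apply: (Bmax (B `|` [set y])).
  split; first by move=> b Bb; left.
  move=> /(_ y (or_intror erefl)) /yB; rewrite y1 => /eqP.
  by rewrite oner_eq0.
split=> [b [/B1//|->//]|b c [Bb|->] [Bc|->]].
- exact: B0.
- by rewrite By.
- by rewrite yB.
- by rewrite eqxx.
Qed.

Lemma get_orthonormal_basis : orthonormal_basis (get (@orthonormal_basis R V)).
Proof. by case: orthonormal_basis_exists => B; exact: getI. Qed.

Lemma orthonormal_nth B s : orthonormal_basis B -> uniq s ->
  {in s, forall b, B b} -> orthonormal (fun i : 'I_(size s) => nth 0 s i).
Proof.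
move=> [B1 B0 _] us sB i j; have [->|ij] := eqVneq i j.
  by rewrite B1//; apply/sB/mem_nth.
by apply: B0; rewrite ?nth_uniq//; apply/sB/mem_nth.
Qed.

Lemma bessel_seq B s x : orthonormal_basis B -> uniq s ->
  {in s, forall b, B b} -> \sum_(b <- s) sqmod (inner x b) <= sqnorm x.
Proof.
move=> oB us sB; rewrite (big_nth 0) big_mkord.
exact: (bessel x (orthonormal_nth oB us sB)).
Qed.

(** Merging repeated vectors is what makes orthonormality applicable. *)
Lemma lin_span_uniq_seq B x : lin_span B x -> exists s (c : V -> R[i]),
  [/\ uniq s, {in s, forall b, B b} & x = \sum_(b <- s) c b *: b].
Proof.
move=> [m [c [v [vB ->]]]].
exists (undup (map v (enum 'I_m))), (fun b => \sum_(i | v i == b) c i).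
split; first exact: undup_uniq.
  by move=> b; rewrite mem_undup => /mapP[i _ ->].
under [RHS]eq_bigr do rewrite scaler_suml.
rewrite (exchange_big_dep xpredT)//=; apply: eq_bigr => i _.
rewrite -big_filter (_ : [seq b <- _ | v i == b] = [:: v i]) ?big_seq1//.
rewrite (eq_filter (a2 := pred1 (v i))); last by move=> b /=; rewrite eq_sym.
apply: filter_pred1_uniq; first exact: undup_uniq.
by rewrite mem_undup map_f ?mem_enum.
Qed.

(** In a complete space the projection of [x] to the closed span of the basis
    differs from [x] by a vector orthogonal to the basis, hence is [x]. *)
Lemma parseval B x : sq_complete V -> orthonormal_basis B ->
  (\esum_(b in B) (sqmod (inner x b))%:E = (sqnorm x)%:E)%E.
Proof.
move=> V_complete oB; apply/eqP; rewrite eq_le; apply/andP; split.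
  apply: ge_ereal_sup => _ [A [finA AB] <-].
  rewrite fsbig_finite//= sumEFin lee_fin; apply: (bessel_seq _ oB).
    exact: finmap.fset_uniq.
  by move=> b; rewrite in_fset_set// inE => /AB.
have [span0 spanlin] := lin_span_submod B.
have [z [zspan zB]] := projection_closure V_complete span0 spanlin x.
have xz : x = z.
  apply/eqP; rewrite -subr_eq0; apply/eqP; case: oB => _ _; apply.
  by move=> b Bb; apply: zB; exact: lin_span_sub.
rewrite -{}xz in zspan; apply/lee_addgt0Pr => e e0.
have [_ /lin_span_uniq_seq[s [c [us sB ->]]] xs] := zspan e e0.
have partial : ((\sum_(b <- s) sqmod (inner x b))%:E
    <= \esum_(b in B) (sqmod (inner x b))%:E)%E.
  apply: esum_ge; exists [set` s]; first by split=> [|b /sB//]; exact: finite_seq.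
  by rewrite -fsbig_seq// sumEFin.
rewrite -leeBlDr//; apply: le_trans partial; rewrite -EFinB lee_fin.
move: xs; rewrite (big_nth 0) big_mkord.
rewrite (sqnorm_sub_orthonormal (fun i : 'I__ => c (nth 0 s i)) x
  (orthonormal_nth oB us sB)).
rewrite [in leRHS](big_nth 0) [in leRHS]big_mkord.
have : 0 <= \sum_(i < size s) sqmod (inner x (nth 0 s i) - c (nth 0 s i)).
  by apply: sumr_ge0 => i _; exact: sqmod_ge0.
lra.
Qed.

End OrthonormalBasis.

(** * Completeness of Hilbert spaces and of square-summable families *)

Section HilbertComplete.
Context {R : realType}.

Lemma cauchy_seq_lim (K : numFieldType) (W : completeNormedModType K)
    (u : nat -> W) :
  (forall e : K, 0 < e -> exists N, forall m n, (N <= m)%N -> (N <= n)%N ->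
    `|u m - u n| < e) ->
  exists l, forall e : K, 0 < e -> exists N, forall m, (N <= m)%N -> `|u m - l| < e.
Proof.
move=> ucauchy.
have /cauchy_cvg/cvg_ex[l ul] : cauchy (u @ \oo).
  apply/cauchy_ballP => e e0; have [N uN] := ucauchy e e0.
  pose tl := [set u m | m in [set m | (N <= m)%N]].
  have tlN : (u @ \oo) tl by exists N => // m Nm; exists m.
  exists (tl, tl) => // -[_ _] [/= [m Nm <-] [n Nn <-]].
  by rewrite -ball_normE; exact: uN.
exists l => e e0; move/cvgrPdistC_lt : ul => /(_ e e0)[N _ uN].
by exists N.
Qed.

Lemma normr_sqnorm (H : hilbertType R) (x : H) : `|x| = (Num.sqrt (sqnorm x))%:C%C.
Proof.
apply/eqP; rewrite -(@eqrXn2 _ 2)// ?lecR ?sqrtr_ge0//.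
by rewrite normr_inner innerrE -rmorphXn/= sqr_sqrtr ?sqnorm_ge0.
Qed.

Lemma normr_lt_sqnorm (H : hilbertType R) (x : H) (e : R) : 0 < e ->
  (`|x| < e%:C%C) = (sqnorm x < e ^+ 2).
Proof.
move=> e0; rewrite normr_sqnorm ltcR -[in LHS](gtr0_norm e0) -sqrtr_sqr.
by rewrite ltr_sqrt// exprn_gt0.
Qed.

Lemma hilbert_complete (H : hilbertType R) : sq_complete H.
Proof.
move=> u ucauchy; have [|l ul] := @cauchy_seq_lim _ H u.
  case=> e i; rewrite ltcE/= => /andP[/eqP-> e0].
  have [N uN] := ucauchy _ (exprn_gt0 2 e0); exists N => m n Nm Nn.
  by rewrite normr_lt_sqnorm//; exact: uN.
exists l => e e0; have e1 : 0 < Num.sqrt e by rewrite sqrtr_gt0.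
have [|N uN] := ul (Num.sqrt e)%:C%C; first by rewrite ltcR.
by exists N => m /uN; rewrite normr_lt_sqnorm// sqr_sqrtr// ltW.
Qed.

Lemma continuous_sqnorm_bounded (H : hilbertType R) (f : {linear H -> H}) :
  continuous f -> exists C : R, forall x, sqnorm (f x) <= C * sqnorm x.
Proof.
move=> fcont; have /linear_boundedP/pinfty_ex_gt0[[c i]] :
    bounded_near f (nbhs (0 : H)) by exact: continuous_linear_bounded (fcont 0).
rewrite ltcE/= => /andP[/eqP-> c0] fc; exists (c ^+ 2) => x.
rewrite -lecR rmorphM rmorphXn/= -!innerrE -!normr_inner -exprMn.
by rewrite ler_pXn2r ?nnegrE// mulr_ge0// lecR ltW.
Qed.

Lemma sqnorm_bounded_continuous (H : hilbertType R) (f : {linear H -> H}) (C : R) :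
  (forall x, sqnorm (f x) <= C * sqnorm x) -> continuous f.
Proof.
move=> fC; apply: bounded_linear_continuous; apply/linear_boundedP.
pose c := `|C| + 1; have c0 : 0 < c by rewrite ltr_wpDl.
have fc x : `|f x| <= c%:C%C * `|x|.
  rewrite -(@ler_pXn2r _ 2) ?nnegrE// ?mulr_ge0 ?lecR ?(ltW c0)//.
  rewrite exprMn !normr_inner !innerrE -rmorphXn -rmorphM lecR.
  apply: le_trans (fC x) _; rewrite ler_wpM2r ?sqnorm_ge0//.
  apply: le_trans (ler_norm C) _; rewrite /c expr2.
  by have := normr_ge0 C; nra.
near=> r => x; apply: le_trans (fc x) _; rewrite ler_wpM2r//.
by near: r; apply: nbhs_pinfty_ge; rewrite complex_real.
Unshelve. all: by end_near. Qed.

Lemma sqmod_complete : sq_complete (R[i]^o : innerProductType R).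
Proof.
have real_lim (v : nat -> R) :
    (forall e : R, 0 < e -> exists N, forall m n, (N <= m)%N -> (N <= n)%N ->
      (v m - v n) ^+ 2 < e) ->
    exists l, forall e : R, 0 < e -> exists N, forall m, (N <= m)%N ->
      (v m - l) ^+ 2 < e.
  move=> vcauchy; have [|l vl] := @cauchy_seq_lim R R^o v.
    move=> e e0; have [N vN] := vcauchy _ (exprn_gt0 2 e0).
    exists N => m n Nm Nn; rewrite -(@ltr_pXn2r _ 2) ?nnegrE ?(ltW e0)//.
    by rewrite real_normK ?num_real ?vN.
  exists l => e e0; have [|N vN] := vl (Num.sqrt e); first by rewrite sqrtr_gt0.
  exists N => m /vN h; rewrite -[e]sqr_sqrtr ?(ltW e0)//.
  by rewrite -[_ ^+ 2]real_normK ?num_real// ltr_pXn2r ?nnegrE ?sqrtr_ge0.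
move=> u ucauchy.
have sqE (c : R[i]^o) : sqnorm c = complex.Re c ^+ 2 + complex.Im c ^+ 2.
  by rewrite -/(sqmod _) -Re_mul_conj.
have ReB m n : complex.Re (u m) - complex.Re (u n) = complex.Re (u m - u n).
  by rewrite raddfB.
have ImB m n : complex.Im (u m) - complex.Im (u n) = complex.Im (u m - u n).
  by rewrite raddfB.
have [|a ua] := real_lim (fun m => complex.Re (u m)).
  move=> e /ucauchy[N uN]; exists N => m n Nm Nn; rewrite ReB.
  by apply: le_lt_trans (uN m n Nm Nn); rewrite sqE lerDl sqr_ge0.
have [|b ub] := real_lim (fun m => complex.Im (u m)).
  move=> e /ucauchy[N uN]; exists N => m n Nm Nn; rewrite ImB.
  by apply: le_lt_trans (uN m n Nm Nn); rewrite sqE lerDr sqr_ge0.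
exists (a +i* b)%C => e e0; have e2 : 0 < e / 2 by rewrite divr_gt0.
have [N1 h1] := ua _ e2; have [N2 h2] := ub _ e2.
exists (maxn N1 N2) => m; rewrite geq_max => /andP[/h1 + /h2].
by rewrite sqE; case: (u m) => c d /=; lra.
Qed.

End HilbertComplete.

Section L2Complete.
Context {R : realType} {I : choiceType} {E : innerProductType R}.

Lemma esum_le_seq (f : I -> R) (c : R) :
  (forall s, uniq s -> \sum_(i <- s) f i <= c) ->
  (\esum_(i in [set: I]) (f i)%:E <= c%:E)%E.
Proof.
move=> fc; apply: ge_ereal_sup => _ [A [finA _] <-].
by rewrite fsbig_finite//= sumEFin lee_fin fc// finmap.fset_uniq.
Qed.

Lemma seq_le_esum (f : I -> R) s : uniq s ->
  ((\sum_(i <- s) f i)%:E <= \esum_(i in [set: I]) (f i)%:E)%E.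
Proof.
move=> us; apply: esum_ge; exists [set` s].
  by split=> //; exact: finite_seq.
by rewrite -fsbig_seq// sumEFin.
Qed.

Lemma sqnorm_l2E (f : l2 I E) :
  (sqnorm f)%:E = (\esum_(i in [set: I]) (sqnorm (f i))%:E)%E.
Proof.
rewrite -rsum_ge0E; last exact: l2_rsummable.
  by [].
by move=> i; exact: sqnorm_ge0.
Qed.

(** Pointwise limits of a Cauchy sequence exist by completeness of [E]; a
    uniform bound on finite partial sums passes to them. *)
Lemma l2_complete : sq_complete E -> sq_complete (l2 I E : innerProductType R).
Proof.
move=> E_complete u ucauchy.
have le_l2 (f : l2 I E) s : uniq s -> \sum_(i <- s) sqnorm (f i) <= sqnorm f.
  by move=> us; rewrite -lee_fin sqnorm_l2E; exact: seq_le_esum.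
have /choice[g gP] i : exists x, sq_cvg (fun m => u m i) x.
  apply: E_complete => e /ucauchy[N uN]; exists N => m n Nm Nn.
  apply: le_lt_trans (uN m n Nm Nn).
  by have := le_l2 (u m - u n) [:: i] isT; rewrite big_seq1.
have sum_cvg s (e : R) : 0 < e -> exists N, forall n, (N <= n)%N ->
    \sum_(i <- s) sqnorm (u n i - g i) < e.
  elim: s e => [|i s IHs] e e0; first by exists 0%N => n _; rewrite big_nil.
  have e2 : 0 < e / 2 by rewrite divr_gt0.
  have [N1 h1] := IHs _ e2; have [N2 h2] := gP i _ e2.
  exists (maxn N1 N2) => n; rewrite geq_max big_cons => /andP[/h1 + /h2].
  by move: (\sum_(_ <- _) _) => ?; lra.
have tail (e : R) : 0 < e -> exists N, forall m, (N <= m)%N ->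
    (\esum_(i in [set: I]) (sqnorm (u m i - g i))%:E <= (4 * e)%:E)%E.
  move=> e0; have [N uN] := ucauchy e e0; exists N => m Nm.
  apply: esum_le_seq => s us; have [N' hN'] := sum_cvg s e e0.
  pose n := maxn N N'.
  have h1 := uN m n Nm (leq_maxl _ _); have h2 := hN' n (leq_maxr _ _).
  have h3 := le_l2 (u m - u n) s us.
  apply: (@le_trans _ _ (2 * \sum_(i <- s) sqnorm ((u m - u n) i)
      + 2 * \sum_(i <- s) sqnorm (u n i - g i))); last by lra.
  rewrite !mulr_sumr -big_split/=; apply: ler_sum => i _.
  exact: sqnorm_trans_le.
have l2diff m : (\esum_(i in [set: I]) (sqnorm (u m i - g i))%:E < +oo)%E ->
    (fun i => u m i - g i) \in square_summable I E by rewrite inE.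
have [N hN] := tail 1 ltr01.
have gl2 : g \in square_summable I E.
  have -> : g = l2_fun (u N) - (fun i => u N i - g i).
    by apply/funext => i; rewrite !fctE opprB addrC subrK.
  apply: rpredB; first exact: valP.
  by apply: l2diff; exact: le_lt_trans (hN N (leqnn _)) (ltry _).
exists (L2 gl2) => e e0; have e8 : 0 < e / 8 by rewrite divr_gt0.
have [N' hN'] := tail _ e8; exists N' => m /hN' h.
rewrite -lte_fin sqnorm_l2E; apply: le_lt_trans h _; rewrite lte_fin; lra.
Qed.

End L2Complete.

(** * Orthonormal bases of spans; square roots of finite-rank positive operators *)

Section GramSchmidt.
Context {R : realType} {V : innerProductType R}.

Lemma orthonormal_lin_indep m (u : 'I_m -> V) : orthonormal u -> lin_indep u.
Proof.
move=> ou c c0 i; rewrite -(inner_orthonormal_sum c i ou) c0.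
exact: inner0l.
Qed.

Lemma gram_schmidt N (v : 'I_N -> V) : exists m (u : 'I_m -> V),
  orthonormal u /\ lin_span (range u) = lin_span (range v).
Proof.
elim: N v => [|N IHN] v.
  by exists 0%N, v; split => // -[].
have [m [u [ou uv]]] := IHN (v \o lift ord0).
have vE : range v = range (v \o lift ord0) `|` [set v ord0].
  apply/seteqP; split=> [_ [i _ <-]|x [[i _ <-]|->]]; last 2 first.
  - by exists (lift ord0 i).
  - by exists ord0.
  by case: (unliftP ord0 i) => [j|] ->; [left; exists j|right].
pose y := v ord0 - \sum_i inner (v ord0) (u i) *: u i.
have usub : lin_span (range u) `<=` lin_span (range v).
  by rewrite uv; apply: lin_span_min => x vx; apply: lin_span_sub; rewrite vE; left.
have yu j : inner y (u j) = 0.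
  by rewrite /y innerBl inner_orthonormal_sum// subrr.
have ydef : v ord0 = y + \sum_i inner (v ord0) (u i) *: u i by rewrite /y subrK.
have [y0|y0] := eqVneq y 0.
  exists m, u; split=> //; apply/seteqP; split=> //.
  apply: lin_span_min; rewrite vE => x [vx|->].
    by rewrite uv; exact: lin_span_sub.
  rewrite ydef y0 add0r; apply: lin_span_sum => i _.
  by apply: lin_span_sub; exists i.
have yy0 : 0 < sqnorm y by rewrite -ltcR -innerrE inner_gt0.
pose a : R[i] := (Num.sqrt (sqnorm y))^-1%:C%C.
have a0 : a != 0.
  by rewrite /a fmorph_eq0 invr_eq0 sqrtr_eq0 -ltNge.
pose u' (i : 'I_m.+1) := oapp u (a *: y) (unlift ord0 i).
have u'0 : u' ord0 = a *: y by rewrite /u' unlift_none.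
have u'S j : u' (lift ord0 j) = u j by rewrite /u' liftK.
have yu' j : inner (u j) y = 0 by rewrite inner_conj yu rmorph0.
exists m.+1, u'; split.
  move=> i j; case: (unliftP ord0 i) (unliftP ord0 j) => [i'|] -> [j'|] ->.
  - by rewrite !u'S ou (inj_eq lift_inj).
  - by rewrite u'S u'0 innerZr yu' mulr0 eq_sym (negPf (neq_lift _ _)).
  - by rewrite u'S u'0 innerZl yu mulr0 (negPf (neq_lift _ _)).
  rewrite u'0 eqxx innerrE sqnormZ_sqmod sqmod_real exprVn sqr_sqrtr ?(ltW yy0)//.
  by rewrite mulVf ?lt0r_neq0.
have u'sub x : lin_span (range u) x -> lin_span (range u') x.
  apply: lin_span_min => _ [i _ <-]; apply: lin_span_sub.
  by exists (lift ord0 i).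
have [lv0 lv] := lin_span_submod (range v).
have [_ lu'] := lin_span_submod (range u').
have vspan : lin_span (range v) (v ord0) by apply: lin_span_sub; exists ord0.
have pspan A : range u `<=` lin_span A ->
    lin_span A (\sum_i inner (v ord0) (u i) *: u i).
  by move=> uA; apply: lin_span_sum => i _; apply: uA; exists i.
apply/seteqP; split; apply: lin_span_min.
  move=> _ [i _ <-]; case: (unliftP ord0 i) => [j|] ->.
    by rewrite u'S; apply: usub; apply: lin_span_sub; exists j.
  rewrite u'0 -[_ *: _]addr0; apply: (lv) => //.
  rewrite /y addrC -scaleN1r; apply: lv => //.
  by apply: pspan => x ux; apply: usub; exact: lin_span_sub.
rewrite vE => x [vx|->].
  by apply: u'sub; rewrite uv; exact: lin_span_sub.
rewrite ydef -[y](scalerK a0) -u'0; apply: lu'.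
  by apply: lin_span_sub; exists ord0.
by apply: pspan => z uz; apply: u'sub; exact: lin_span_sub.
Qed.

Lemma orthonormal_has_dim m (u : 'I_m -> V) : orthonormal u ->
  has_dim (lin_span (range u)) m.
Proof. by move=> ou; exists u; split => //; exact: orthonormal_lin_indep. Qed.

Lemma orthonormal_span (J : finType) (w : J -> V) :
  exists u : 'I_(Defs.dim (lin_span (range w))) -> V,
    orthonormal u /\ lin_span (range u) = lin_span (range w).
Proof.
have [m [u [ou uw]]] := gram_schmidt (fun i : 'I_#|J| => w (enum_val i)).
have wE : range (fun i : 'I_#|J| => w (enum_val i)) = range w.
  apply/seteqP; split=> _ [i _ <-]; first by exists (enum_val i).
  by exists (enum_rank i) => //; rewrite enum_rankK.
rewrite wE in uw; have := orthonormal_has_dim ou; rewrite uw => /dimE d.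
by rewrite d; exists u.
Qed.

Lemma dim_span_le (J : finType) (w : J -> V) :
  (Defs.dim (lin_span (range w)) <= #|J|)%N.
Proof.
have [u [ou uw]] := orthonormal_span w.
apply: (steinitz (w := w) (orthonormal_lin_indep ou)) => i.
by rewrite -uw; apply: lin_span_sub; exists i.
Qed.

End GramSchmidt.

Section PositiveOperators.
Context {R : realType} {H : hilbertType R}.
Implicit Types (A S : {linear H -> H}) (x y : H).

(** Polarisation: over the complex numbers a real quadratic form forces
    symmetry. *)
Lemma positive_symmetric A : positive_op A ->
  forall x y, inner (A x) y = inner x (A y).
Proof.
move=> Apos; have real z : complex.Im (inner (A z) z) = 0.
  exact: ger0_Im (Apos z).
move=> x y; have := real (x + y); have := real (x + 'i%C *: y).
have := real x; have := real y.
rewrite !linearD/= !linearZ/= !innerDl !innerDr !innerZl !innerZr.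
rewrite [inner x (A y)]inner_conj.
case: (inner (A x) x) (inner (A x) y) (inner (A y) x) (inner (A y) y)
  => [a a'] [b b'] [c c'] [d d'] /= -> -> h1 h2.
by apply/eqP; rewrite eq_complex/=; apply/andP; split; apply/eqP; lra.
Qed.

(** The operator is diagonalised in an orthonormal basis [w] of its range by the
    spectral theorem for Hermitian matrices, and the square root is taken on the
    eigenvalues. *)
Lemma sqrt_op_exists A r (u : 'I_r -> H) : positive_op A ->
  orthonormal u -> lin_span (range u) = range A ->
  exists S : {linear H -> H},
    [/\ continuous S, positive_op S & forall x, S (S x) = A x].
Proof.
move=> Apos ou uA; have Asym := positive_symmetric Apos.
have Aexp x : A x = \sum_i inner (A x) (u i) *: u i.
  have /lin_spanP[c /(orthonormal_expand ou)//] : lin_span (range u) (A x).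
  by rewrite uA; exists x.
pose M : 'M[R[i]]_r := \matrix_(i, j) inner (A (u i)) (u j).
have Mherm : map_mx Num.conj M^T = M.
  by apply/matrixP => i j; rewrite !mxE -inner_conj Asym.
have /orthomx_spectralP ME : M \is normalmx by apply/normalmxP; rewrite Mherm.
have Punit := spectral_unit M; have Puni := spectral_unitarymx M.
set P := spectralmx M in ME Punit Puni; set D := spectral_diag M in ME.
pose w s := \sum_i P s i *: u i.
have Aw s : A (w s) = D 0 s *: w s.
  have PM : P *m M = diag_mx D *m P by rewrite ME !mulmxA mulmxV// mul1mx.
  rewrite linear_sum /w scaler_sumr.
  transitivity (\sum_j (P *m M) s j *: u j).
    under eq_bigr do rewrite linearZ/= Aexp scaler_sumr.
    rewrite exchange_big; apply: eq_bigr => j _ /=.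
    rewrite mxE scaler_suml; apply: eq_bigr => i _.
    by rewrite scalerA mxE.
  by apply: eq_bigr => j _; rewrite PM mul_diag_mx mxE scalerA.
have ow : orthonormal w.
  move=> s t; have /unitarymxP/matrixP/(_ s t) := Puni.
  rewrite !mxE => <-; rewrite inner_sumr; apply: eq_bigr => i _.
  by rewrite innerZr inner_orthonormal_sum// !mxE mulrC.
have uw i : u i = \sum_s Num.conj (P s i) *: w s.
  have PP : map_mx Num.conj P^T *m P = 1%:M by rewrite -invmx_unitary// mulVmx.
  transitivity (\sum_j (map_mx Num.conj P^T *m P) i j *: u j).
    rewrite PP (bigD1 i)//= mxE eqxx scale1r big1 ?addr0// => j ji.
    by rewrite mxE eq_sym (negPf ji) scale0r.
  under [RHS]eq_bigr do rewrite scaler_sumr.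
  rewrite exchange_big; apply: eq_bigr => j _ /=.
  rewrite mxE scaler_suml; apply: eq_bigr => s _.
  by rewrite scalerA !mxE.
pose d s : R := complex.Re (D 0 s).
have dE s : D 0 s = (d s)%:C%C /\ 0 <= d s.
  have := Apos (w s); rewrite Aw innerZl ow eqxx mulr1 lecE /d/=.
  by case: (D 0 s) => [a b] /= /andP[/eqP-> ?].
have Aexpw x : A x = \sum_s ((d s)%:C%C * inner x (w s)) *: w s.
  have : lin_span (range w) (A x).
    rewrite Aexp; apply: lin_span_sum => i _; rewrite uw.
    by apply: lin_span_sum => s _; apply: lin_span_sub; exists s.
  move=> /lin_spanP[c /(orthonormal_expand ow) ->]; apply: eq_bigr => s _.
  by rewrite Asym Aw innerZr (dE s).1 conj_real_complex.
pose f x := \sum_s ((Num.sqrt (d s))%:C%C * inner x (w s)) *: w s.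
have flin : linear f.
  move=> a x y; rewrite /f scaler_sumr -big_split/=; apply: eq_bigr => s _.
  by rewrite innerP scalerA -scalerDl; congr (_ *: _); ring.
pose S : {linear H -> H} := HB.pack f (GRing.isLinear.Build R[i] H H *:%R f flin).
exists S; split.
- apply: (@sqnorm_bounded_continuous _ _ _ (\sum_s d s)) => x.
  rewrite [S x]/(f x) /f sqnorm_orthonormal_sum// mulr_suml.
  apply: ler_sum => s _; rewrite sqmodM sqmod_real sqr_sqrtr ?(dE s).2//.
  rewrite ler_wpM2l ?(dE s).2//; apply: le_trans (Cauchy_Schwarz _ _) _.
  by rewrite [sqnorm (w s)]/sqnorm ow eqxx mulr1.
- move=> x; rewrite [S x]/(f x) /f inner_suml; apply: sumr_ge0 => s _.
  rewrite innerZl -mulrA [inner (w s) x]inner_conj.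
  by rewrite mulr_ge0 ?mul_conjC_ge0// lecR sqrtr_ge0.
- move=> x; rewrite Aexpw [S x]/(f x) [S _]/(f _) /f; apply: eq_bigr => s _.
  rewrite inner_orthonormal_sum// mulrA -rmorphM -expr2.
  by rewrite sqr_sqrtr ?(dE s).2.
Qed.

Section SquareRoot.
Context {A : {linear H -> H}} {r : nat} {u : 'I_r -> H}.
Hypotheses (Apos : positive_op A) (ou : orthonormal u)
  (uA : lin_span (range u) = range A).

Lemma sqrt_opP : [/\ continuous (sqrt_op A), positive_op (sqrt_op A)
  & forall x, sqrt_op A (sqrt_op A x) = A x].
Proof.
have := sqrt_op_exists Apos ou uA.
exact: (@getPex _ [set S : {linear H -> H} |
  [/\ continuous S, positive_op S & forall x, S (S x) = A x]]).
Qed.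

Lemma sqrt_op_symmetric x y : inner (sqrt_op A x) y = inner x (sqrt_op A y).
Proof. by have [_ Spos _] := sqrt_opP; exact: positive_symmetric. Qed.

Lemma sqnorm_sqrt_op x : sqnorm (sqrt_op A x) = complex.Re (inner (A x) x).
Proof.
have [_ _ SS] := sqrt_opP.
by rewrite /sqnorm -sqrt_op_symmetric SS.
Qed.

(** The component [z] of [S x] orthogonal to the range of [A] is killed by [A],
    hence by its square root [S], so that it is orthogonal to [S x]. *)
Lemma sqrt_op_range x : range A (sqrt_op A x).
Proof.
set S := sqrt_op A.
pose p := \sum_i inner (S x) (u i) *: u i; pose z := S x - p.
have pA : range A p.
  by rewrite -uA; apply/lin_spanP; exists (fun i => inner (S x) (u i)).
have zA y : inner z (A y) = 0.
  have : range A (A y) by exists y.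
  rewrite -uA => /lin_spanP[c ->]; rewrite inner_sumr big1// => i _.
  by rewrite innerZr /z innerBl inner_orthonormal_sum// subrr mulr0.
have Sz : S z = 0.
  apply: sqnorm_eq0; rewrite sqnorm_sqrt_op (positive_symmetric Apos).
  by rewrite zA.
suff z0 : z = 0 by rewrite -[S x](subrK p) -/z z0 add0r.
apply: sqnorm_eq0; rewrite /sqnorm {2}/z innerBr -sqrt_op_symmetric -/S Sz.
by have [q _ <-] := pA; rewrite zA inner0l subr0.
Qed.

End SquareRoot.

End PositiveOperators.

(** * Composites of families of operators and sums over tuples of words *)

Section FiniteSums.
Context {R : realType}.

Lemma ler_sum_inj (I J : finType) (phi : I -> J) (F : J -> R) :
  injective phi -> (forall j, 0 <= F j) -> \sum_i F (phi i) <= \sum_j F j.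
Proof.
move=> phi_inj F0.
rewrite -(big_imset (h := phi) F (A := predT))/=; last by move=> i j _ _; exact: phi_inj.
by rewrite [leRHS](bigID (mem (phi @: predT)))/= lerDl sumr_ge0.
Qed.

Lemma card_dffun k (U : 'I_k -> finType) :
  #|{dffun forall i, U i}| = (\prod_(i < k) #|U i|)%N.
Proof. by rewrite card_dep_ffun foldrE big_map big_enum. Qed.

End FiniteSums.

Section Composites.
Context {X : Type}.

Lemma comps_commute k (F : 'I_k -> X -> X) (G : X -> X) x :
  (forall i x, G (F i x) = F i (G x)) ->
  G ((\big[comp/id]_(i < k) F i) x) = (\big[comp/id]_(i < k) F i) (G x).
Proof.
elim: k F => [|k IHk] F GF; first by rewrite big_ord0.
by rewrite big_ord_recl /= GF IHk.
Qed.

Lemma comps_comp k (F G : 'I_k -> X -> X) x :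
  (forall s t, s != t -> forall x, F s (G t x) = G t (F s x)) ->
  (\big[comp/id]_(i < k) (F i \o G i)) x =
  (\big[comp/id]_(i < k) F i) ((\big[comp/id]_(i < k) G i) x).
Proof.
elim: k F G => [|k IHk] F G FG; first by rewrite !big_ord0.
rewrite !big_ord_recl /= IHk; last first.
  by move=> s t st y; apply: FG; rewrite (inj_eq lift_inj).
congr (F ord0 _); apply: comps_commute => i y.
by rewrite FG// eq_sym neq_lift.
Qed.

Lemma comps_ind k (F : 'I_k -> X -> X) (P : X -> Prop) x :
  (forall i x, P x -> P (F i x)) -> P x -> P ((\big[comp/id]_(i < k) F i) x).
Proof.
elim: k F => [|k IHk] F FP Px; first by rewrite big_ord0.
rewrite big_ord_recl /=; apply: (FP); apply: IHk => // i y; exact: FP.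
Qed.

End Composites.

Lemma comps_linear (K : pzRingType) (V : lmodType K) k (F : 'I_k -> V -> V) :
  (forall i, linear (F i)) -> linear (\big[comp/id]_(i < k) F i).
Proof.
elim: k F => [|k IHk] F Flin a x y; first by rewrite big_ord0.
by rewrite big_ord_recl /= IHk// Flin.
Qed.

(** Commutation across indices lets the adjoint keep the order of factors. *)
Lemma comps_adjoint (R : realType) (V : innerProductType R) k
    (F G : 'I_k -> V -> V) :
  (forall s t, s != t -> forall x, F s (F t x) = F t (F s x)) ->
  (forall i x y, inner (F i x) y = inner x (G i y)) ->
  forall x y, inner ((\big[comp/id]_(i < k) F i) x) y =
    inner x ((\big[comp/id]_(i < k) G i) y).
Proof.
elim: k F G => [|k IHk] F G FF FG x y; first by rewrite !big_ord0.
rewrite !big_ord_recl /= comps_commute; last first.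
  by move=> i z; rewrite FF// neq_lift.
rewrite (IHk _ (fun i => G (lift ord0 i))) ?FG// => s t st z.
by rewrite FF// (inj_eq lift_inj).
Qed.

(** Summing out the outermost operator replaces [Q 0] by [Q 1], and so on
    inwards: this is why the estimate at index [i] relates [Q i] to [Q i.+1]. *)
Lemma sum_dffun_comps_le (R : realType) (X : Type) k (U : 'I_k -> finType)
    (A : forall i, U i -> X -> X) (Q : nat -> X -> R) h :
  (forall j h, 0 <= Q j h) ->
  (forall (i : 'I_k) h, \sum_(u : U i) Q i (A i u h) <= Q i.+1 h) ->
  \sum_(f : {dffun forall i, U i}) Q 0%N ((\big[comp/id]_(i < k) A i (f i)) h)
    <= Q k h.
Proof.
elim: k U A Q => [|k IHk] U A Q Q0 QA.
  under eq_bigr do rewrite big_ord0.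
  by rewrite sumr_const card_dffun big_ord0.
pose U' (i : 'I_k) := U (lift ord0 i).
pose A' (i : 'I_k) := A (lift ord0 i).
pose split_fun (f : {dffun forall i, U i}) :
    U ord0 * {dffun forall i, U' i} := (f ord0, [ffun i => f (lift ord0 i)]).
have split_inj : injective split_fun.
  move=> f g [f0 /ffunP fS]; apply/ffunP => i.
  by case: (unliftP ord0 i) => [j|] -> //; have := fS j; rewrite !ffunE.
pose G (p : U ord0 * {dffun forall i, U' i}) :=
  Q 0%N (A ord0 p.1 ((\big[comp/id]_(i < k) A' i (p.2 i)) h)).
apply: (@le_trans _ _ (\sum_p G p)).
  apply: le_trans (ler_sum_inj split_inj _); last by move=> p; exact: Q0.
  apply: ler_sum => f _; rewrite big_ord_recl /= /G/=.
  by under [in leRHS]eq_bigr do rewrite ffunE.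
apply: le_trans (IHk U' A' (fun j => Q j.+1) _ _); last 2 first.
- by move=> j; exact: Q0.
- by move=> i h'; exact: (QA (lift ord0 i)).
rewrite -(pair_bigA _ (fun u f => G (u, f)))/= exchange_big/=.
by apply: ler_sum => f _;
  exact: (QA ord0 ((\big[comp/id]_(i < k) A' i (f i)) h)).
Qed.

Section BoundedWords.
Context {R : realType} {X : Type} {T : finType}.

Lemma sum_bseqS (M : nat) (F : seq T -> R) : (forall s, 0 <= F s) ->
  \sum_(b : {bseq M.+1 of T}) F b <=
  F [::] + \sum_(a : T) \sum_(b : {bseq M of T}) F (a :: b).
Proof.
move=> F0.
pose uncons (b : {bseq M.+1 of T}) : unit + T * {bseq M of T} :=
  if b : seq T is a :: s then inr (a, insub_bseq M s) else inl tt.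
have uncons_inj : injective uncons.
  move=> [s /= sM] [t /= tM]; rewrite /uncons/=.
  case: s t sM tM => [|a s] [|b t]//= sM tM; first by move=> _; exact: val_inj.
  move=> [-> /(congr1 val)]; rewrite /insub_bseq !insubdK//.
  by move=> st; apply: val_inj; rewrite /= st.
pose G (x : unit + T * {bseq M of T}) :=
  match x with inl _ => F [::] | inr (a, b) => F (a :: bseqval b) end.
apply: (@le_trans _ _ (\sum_x G x)).
  apply: le_trans (ler_sum_inj uncons_inj _); last by case=> [u|[a b]]; exact: F0.
  apply: ler_sum => -[[|a s] sM] _; rewrite /uncons/=//.
  by rewrite /insub_bseq insubdK.
rewrite big_sumType/= (big_pred1 tt); last by case.
by rewrite lerD2l pair_bigA/=; apply: ler_sum => -[a b] _.
Qed.

(** The telescoping identity behind the contractivity of the Berezin kernel, for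
    one index: [Q h] is what remains of [Q' h] after subtracting the
    contributions of the letters. *)
Lemma sum_bseq_foldl_le (A : T -> X -> X) (Q Q' : X -> R) :
  (forall h, 0 <= Q h) -> (forall h, 0 <= Q' h) ->
  (forall h, Q h + \sum_(a : T) Q' (A a h) = Q' h) ->
  forall M h, \sum_(b : {bseq M of T}) Q (foldl (fun h a => A a h) h b) <= Q' h.
Proof.
move=> Q0 Q'0 QQ'; elim=> [|M IHM] h.
  rewrite (eq_bigr (fun=> Q h)) => [|[[|//] ?] _//].
  rewrite sumr_const card_bseq big_ord1 expn0 -QQ' lerDl.
  by apply: sumr_ge0 => a _.
have /le_trans := sum_bseqS M (F := fun s => Q (foldl (fun h a => A a h) h s))
  (fun s => Q0 _).
apply => /=.
by rewrite -[leRHS]QQ' lerD2l; apply: ler_sum => a _; exact: IHM.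
Qed.

End BoundedWords.

(** * Tuples in the regular polyball and their words *)

Section IteratedComposites.
Context {X : Type} {k : nat} (G : 'I_k -> X -> X).

Lemma comps_single i x :
  (\big[comp/id]_(s < k) iter (s == i) (G s)) x = G i x.
Proof.
elim: k G i => [|m IHm] F i; first by case: i.
rewrite big_ord_recl /=; case: (unliftP ord0 i) => [j|] ->.
  rewrite (negPf (neq_lift _ _)) /= -[RHS](IHm (fun s => F (lift ord0 s))).
  by under eq_bigr do rewrite (inj_eq lift_inj).
rewrite eqxx /=; congr (F ord0 _).
by apply: (comps_ind (P := fun y => y = x)) => // s y ->.
Qed.

Lemma comps_iter_ge (j : 'I_k) x :
  (\big[comp/id]_(i < k) iter (j <= i)%N (G i)) x =
  G j ((\big[comp/id]_(i < k) iter (j < i)%N (G i)) x).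
Proof.
elim: k G j => [|m IHm] F j; first by case: j.
rewrite !big_ord_recl /=; case: (unliftP ord0 j) => [i|] -> //=.
exact: (IHm (fun s => F (lift ord0 s))).
Qed.

End IteratedComposites.

Section FiniteWordTypes.
Context {k : nat} (n : 'I_k -> nat) (q : 'I_k -> nat).

(** Finite types in place of subsets of the countable type of words, so that
    sums and cardinals over them are those of finite types. *)
Definition bwords : finType := {dffun forall i, {bseq q i of 'I_(n i)}}.

Definition twords : finType := {dffun forall i, (q i).-tuple 'I_(n i)}.

Definition bword (f : bwords) : words n := fun i => f i.

Definition tword (f : twords) : words n := fun i => f i.

End FiniteWordTypes.

Section PolyballWords.
Context {R : realType} {H : hilbertType R} {k : nat} {n : 'I_k -> nat}.
Variable T : forall i : 'I_k, 'I_(n i) -> {linear H -> H}.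
Hypothesis T_polyball : regular_polyball T.
Implicit Types (x y h : H) (b : words n).

Lemma polyball_adjP i j x y : inner (T j x) y = inner x (adj (T (i := i) j) y).
Proof.
have [Tcont _ _] := T_polyball.
have [C TC] := continuous_sqnorm_bounded (Tcont i j).
by apply: (adjP (@hilbert_complete R H) _ TC) => a u v; rewrite linearP.
Qed.

(** The quadratic form of the defect of the variables from [j] on; it
    interpolates between the full defect ([j = 0]) and the norm ([j = k]). *)
Definition partial_defect (j : nat) h : R :=
  complex.Re (inner (Delta_pow T (fun i : 'I_k => (j <= i)%N) idfun h) h).

Lemma partial_defect_ge0 j h : 0 <= partial_defect j h.
Proof.
have [_ _ /(_ (fun i : 'I_k => (j <= i)%N) h)] := T_polyball.
by rewrite lecE/= => /andP[].
Qed.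

Lemma inner_id_sub_Phi i (Y : {linear H -> H}) h :
  inner (id_sub_Phi (T (i := i)) Y h) h =
  inner (Y h) h - \sum_j inner (Y (adj (T (i := i) j) h)) (adj (T (i := i) j) h).
Proof.
rewrite innerBl; congr (_ - _); rewrite /Phi inner_suml.
by apply: eq_bigr => j _; rewrite polyball_adjP.
Qed.

Lemma partial_defect_step (i : 'I_k) h :
  partial_defect i h + \sum_j partial_defect i.+1 (adj (T (i := i) j) h) =
  partial_defect i.+1 h.
Proof.
rewrite /partial_defect /Delta_pow (comps_iter_ge (fun i => id_sub_Phi (T (i := i)))).
by rewrite inner_id_sub_Phi raddfB/= Re_sum subrK.
Qed.

Lemma partial_defect0 h : partial_defect 0 h = complex.Re (inner (defect T h) h).
Proof. by []. Qed.

Lemma partial_defectk h : partial_defect k h = sqnorm h.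
Proof.
have E : Delta_pow T (fun i : 'I_k => (k <= i)%N) idfun = idfun.
  apply: (comps_ind (P := fun Y : {linear H -> H} => Y = idfun)) => // i Y ->.
  by rewrite leqNgt ltn_ord.
by rewrite /partial_defect E.
Qed.

Lemma defect_positive : positive_op (defect T).
Proof. by have [_ _ /(_ (fun=> true))] := T_polyball. Qed.

(** Positivity of the defect of the single index [i] says that the squared
    norms of the adjoints of its letters add up to at most the squared norm. *)
Lemma polyball_contraction i (j : 'I_(n i)) x : sqnorm (T j x) <= sqnorm x.
Proof.
have adj_contraction h : sqnorm (adj (T j) h) <= sqnorm h.
  have [_ _ /(_ (fun s => s == i) h)] := T_polyball.
  rewrite /Delta_pow (comps_single (fun i => id_sub_Phi (T (i := i)))).
  rewrite inner_id_sub_Phi lecE/= => /andP[_].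
  rewrite raddfB/= Re_sum subr_ge0; apply: le_trans.
  by rewrite (bigD1 j)//= lerDl sumr_ge0// => l _; exact: sqnorm_ge0.
have := Re_inner_young x (adj (T j) (T j x)).
by rewrite -polyball_adjP -/(sqnorm _); have := adj_contraction (T j x); lra.
Qed.

Lemma word_op_cons i j (a : seq 'I_(n i)) x :
  word_op T (j :: a) x = T j (word_op T a x).
Proof. by rewrite /word_op big_cons. Qed.

Lemma word_op_cat i (a c : seq 'I_(n i)) x :
  word_op T (a ++ c) x = word_op T a (word_op T c x).
Proof.
by elim: a => [|j a IHa]; rewrite ?cat_cons ?word_op_cons ?IHa// /word_op big_nil.
Qed.

Lemma word_op_linear i (a : seq 'I_(n i)) : linear (word_op T a).
Proof.
elim: a => [|j a IHa] c x y; first by rewrite /word_op big_nil.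
by rewrite !word_op_cons IHa linearP.
Qed.

Lemma word_op_contraction i (a : seq 'I_(n i)) x :
  sqnorm (word_op T a x) <= sqnorm x.
Proof.
elim: a => [|j a IHa]; first by rewrite /word_op big_nil.
by rewrite word_op_cons (le_trans (polyball_contraction _ _)).
Qed.

Lemma word_op_commute s t (a : seq 'I_(n s)) (c : seq 'I_(n t)) x : s != t ->
  word_op T a (word_op T c x) = word_op T c (word_op T a x).
Proof.
move=> st; have [_ Tcomm _] := T_polyball.
have one j y : T (i := s) j (word_op T c y) = word_op T c (T j y).
  elim: c => [|l c IHc]; first by rewrite /word_op !big_nil.
  by rewrite !word_op_cons Tcomm// IHc.
elim: a => [|j a IHa]; first by rewrite /word_op !big_nil.
by rewrite !word_op_cons IHa one.
Qed.

Lemma word_op_adjP i (a : seq 'I_(n i)) x y :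
  inner (word_op T a x) y = inner x (adj (word_op T a) y).
Proof.
apply: (adjP (C := 1) (@hilbert_complete R H)); first exact: word_op_linear.
by move=> z; rewrite mul1r; exact: word_op_contraction.
Qed.

Lemma adj_word_op i (a : seq 'I_(n i)) y :
  adj (word_op T a) y = foldl (fun h j => adj (T (i := i) j) h) y a.
Proof.
apply: inner_extr => x; rewrite -word_op_adjP.
elim: a y => [|j a IHa] y /=; first by rewrite /word_op big_nil.
by rewrite word_op_cons polyball_adjP IHa.
Qed.

Definition words_op b : H -> H := \big[comp/id]_(i < k) word_op T (b i).

Definition words_adj b : H -> H :=
  \big[comp/id]_(i < k) (adj (word_op T (b i)) : H -> H).

Lemma words_op_linear b : linear (words_op b).
Proof. by apply: comps_linear => i; exact: word_op_linear. Qed.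

Lemma words_adj_linear b : linear (words_adj b).
Proof. by apply: comps_linear => i a x y; rewrite linearP. Qed.

Lemma words_op_sum b (J : finType) (c : J -> R[i]) (v : J -> H) :
  words_op b (\sum_j c j *: v j) = \sum_j c j *: words_op b (v j).
Proof.
pose f : {linear H -> H} :=
  HB.pack (words_op b) (GRing.isLinear.Build R[i] H H *:%R _ (words_op_linear b)).
rewrite -[words_op b]/(f : H -> H) linear_sum.
by apply: eq_bigr => j _; rewrite linearZ.
Qed.

Lemma words_op_contraction b x : sqnorm (words_op b x) <= sqnorm x.
Proof.
apply: (comps_ind (P := fun y => sqnorm y <= sqnorm x)) => // i y.
exact/le_trans/word_op_contraction.
Qed.

Lemma words_op_cat b c x :
  words_op (fun i => b i ++ c i) x = words_op b (words_op c x).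
Proof.
rewrite /words_op -comps_comp; last by move=> s t st y; exact: word_op_commute.
congr (_ x); apply: eq_bigr => i _; apply/funext => y.
exact: word_op_cat.
Qed.

Lemma words_adjP b x y : inner (words_op b x) y = inner x (words_adj b y).
Proof.
apply: comps_adjoint => [s t st z|i z w]; first exact: word_op_commute.
exact: word_op_adjP.
Qed.

(** The Berezin kernel is a contraction because the partial defects lead from
    the defect to the identity, each step being the telescoping sum over the words
    of one index. *)
Lemma sum_defect_words_le M h :
  \sum_(f : bwords n (fun=> M))
    complex.Re (inner (defect T (words_adj (bword f) h)) (words_adj (bword f) h))
  <= sqnorm h.
Proof.
rewrite -partial_defectk.
under eq_bigr do rewrite -partial_defect0 /words_adj /bword.
have step (i : 'I_k) y : \sum_(a : {bseq M of 'I_(n i)})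
    partial_defect i (adj (word_op T a) y) <= partial_defect i.+1 y.
  under eq_bigr do rewrite adj_word_op.
  apply: (sum_bseq_foldl_le (partial_defect_ge0 i) (partial_defect_ge0 i.+1)).
  exact: partial_defect_step.
exact: sum_dffun_comps_le h partial_defect_ge0 step.
Qed.

End PolyballWords.

(** * The Berezin kernel and the terms of the curvature *)

Section SumsOverWords.
Context {R : realType} {I : choiceType}.

Lemma ler_sum_uniq (F : I -> R) s s' : (forall i, 0 <= F i) -> uniq s -> uniq s' ->
  (forall i, i \in s -> F i != 0 -> i \in s') ->
  \sum_(i <- s) F i <= \sum_(i <- s') F i.
Proof.
move=> F0 us us' ss'; rewrite (bigID (mem s'))/= [X in _ + X]big1_seq ?addr0.
  rewrite -big_filter [leRHS](bigID (mem s))/= -[in leRHS]big_filter.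
  rewrite (perm_big [seq i <- s' | i \in s])/= ?lerDl ?sumr_ge0//.
  apply: uniq_perm; rewrite ?filter_uniq// => i.
  by rewrite !mem_filter andbC.
by move=> i /andP[is' si]; apply: contraNeq is'; exact: ss'.
Qed.

Lemma esum_finType (J : finType) (e : J -> I) (F : I -> R) : injective e ->
  (forall i, 0 <= F i) -> (forall i, F i != 0 -> exists j, e j = i) ->
  (\esum_(i in [set: I]) (F i)%:E = (\sum_j F (e j))%:E)%E.
Proof.
move=> e_inj F0 Fe; pose s' := [seq e j | j <- enum J].
have us' : uniq s' by rewrite map_inj_uniq ?enum_uniq.
have sE : \sum_j F (e j) = \sum_(i <- s') F i by rewrite big_map big_enum.
rewrite sE; apply/eqP; rewrite eq_le seq_le_esum// andbT.
apply: esum_le_seq => s us; apply: ler_sum_uniq => // i _ /Fe[j <-].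
by rewrite map_f ?mem_enum.
Qed.

Lemma rsum_single (j : I) (c : R) :
  rsum (fun i => if i == j then c else 0) = c.
Proof.
have single (d : R) : 0 <= d ->
    fine (\esum_(i in [set: I]) (if i == j then d else 0)%:E)%E = d.
  move=> d0; rewrite (@esum_finType unit (fun=> j) (fun i => if i == j then d else 0)).
  - by rewrite (big_pred1 tt)/= ?eqxx//; case.
  - by move=> [] [].
  - by move=> i; case: ifP.
  - by move=> i; case: (i =P j) => [->|_]; [exists tt|rewrite eqxx].
rewrite /rsum.
rewrite (eq_esum (b := fun i => (if i == j then Num.max c 0 else 0)%:E)); last first.
  by move=> i _; rewrite funeposE /= -EFin_max; case: ifP; rewrite ?maxxx.
rewrite [X in _ - fine X]
  (eq_esum (b := fun i => (if i == j then Num.max (- c) 0 else 0)%:E)); last first.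
  move=> i _; rewrite funenegE /= -EFin_max.
  by case: ifP; rewrite ?oppr0 ?maxxx.
rewrite !single ?le_max ?lexx ?orbT//.
by case: (lerP c 0) => ?; case: (lerP (- c) 0) => ?; lra.
Qed.

End SumsOverWords.

Section WordEnumeration.
Context {k : nat} {n : 'I_k -> nat} {q : 'I_k -> nat}.

Lemma bword_inj : injective (@bword k n q).
Proof.
move=> f g fg; apply/ffunP => i; apply: val_inj.
exact: (congr1 (fun b : words n => b i) fg).
Qed.

Lemma tword_inj : injective (@tword k n q).
Proof.
move=> f g fg; apply/ffunP => i; apply: val_inj.
exact: (congr1 (fun b : words n => b i) fg).
Qed.

Lemma bwordP (b : words n) : (forall i, (size (b i) <= q i)%N) ->
  exists f : bwords n q, bword f = b.
Proof.
move=> bq; exists [ffun i => Bseq (bq i)].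
by apply: functional_extensionality_dep => i; rewrite /bword ffunE.
Qed.

Lemma twordP (b : words n) : (forall i, size (b i) == q i) ->
  exists f : twords n q, tword f = b.
Proof.
move=> bq; exists [ffun i => Tuple (bq i)].
by apply: functional_extensionality_dep => i; rewrite /tword ffunE.
Qed.

Lemma size_bword (f : bwords n q) i : (size (bword f i) <= q i)%N.
Proof. exact: size_bseq. Qed.

Lemma size_tword (f : twords n q) i : size (tword f i) = q i.
Proof. exact: size_tuple. Qed.

Lemma card_twords : #|twords n q| = (\prod_(i < k) n i ^ q i)%N.
Proof.
by rewrite card_dffun; apply: eq_bigr => i _; rewrite card_tuple card_ord.
Qed.

Lemma card_bwords :
  #|bwords n q| = (\prod_(i < k) \sum_(j < (q i).+1) n i ^ j)%N.
Proof.
by rewrite card_dffun; apply: eq_bigr => i _; rewrite card_bseq card_ord.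
Qed.

End WordEnumeration.

Section Berezin.
Context {R : realType} {H : hilbertType R} {k : nat} {n : 'I_k -> nat}.
Variable T : forall i : 'I_k, 'I_(n i) -> {linear H -> H}.
Hypothesis T_polyball : regular_polyball T.
Context {r : nat} {u : 'I_r -> H}.
Hypotheses (ou : orthonormal u) (uT : lin_span (range u) = range (defect T)).
Implicit Types (x y h : H) (b : words n) (q : 'I_k -> nat).

Local Notation S := (sqrt_op (defect T)).
Let Tpos := defect_positive T_polyball.

Lemma sqnorm_sqrt_defect x : sqnorm (S x) = complex.Re (inner (defect T x) x).
Proof. exact: sqnorm_sqrt_op. Qed.

Let Srange x : S x \in range_closure_pred (defect T).
Proof.
apply/mem_set/subset_closure; exact: (sqrt_op_range Tpos ou uT).
Qed.

Let Kcoord h : words n -> range_closure (defect T) :=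
  fun b => insubd (0 : range_closure (defect T)) (S (words_adj T b h)).

Let Kcoord_val h b : val (Kcoord h b) = S (words_adj T b h).
Proof. exact: insubdK. Qed.

Let sqnorm_Kcoord h b : sqnorm (Kcoord h b) = sqnorm (S (words_adj T b h)).
Proof. by rewrite -Kcoord_val. Qed.

Lemma sum_words_sqrt_le h s : uniq s ->
  \sum_(b <- s) sqnorm (S (words_adj T b h)) <= sqnorm h.
Proof.
move=> us; pose M := (\max_(b <- s) \max_i size (b i))%N.
apply: le_trans (sum_defect_words_le T_polyball M h).
under [leRHS]eq_bigr do rewrite -sqnorm_sqrt_defect.
rewrite -[leRHS]big_enum -(big_map (@bword k n _) xpredT
  (fun b => sqnorm (S (words_adj T b h)))).
apply: ler_sum_uniq => //.
- by move=> b; exact: sqnorm_ge0.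
- by rewrite map_inj_uniq ?enum_uniq//; exact: bword_inj.
move=> b sb _; have [f <-] : exists f : bwords n (fun=> M), bword f = b.
  apply: bwordP => i; apply: (@leq_trans (\max_i size (b i))%N).
    exact: (leq_bigmax (F := fun i => size (b i))).
  exact: (@leq_bigmax_seq _ s xpredT (fun b : words n => \max_i size (b i))%N).
by rewrite map_f ?mem_enum.
Qed.

Let Kcoord_l2 h : Kcoord h \in square_summable (words n) (range_closure (defect T)).
Proof.
rewrite inE; apply: le_lt_trans (ltry (sqnorm h)); apply: esum_le_seq => s us.
by under eq_bigr do rewrite sqnorm_Kcoord; exact: sum_words_sqrt_le.
Qed.

Lemma berezin_val h b : val (berezin T h b) = S (words_adj T b h).
Proof.
rewrite -Kcoord_val; congr val.
exact: (congr1 (fun f : words n -> _ => f b) (insubdK _ (Kcoord_l2 h))).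
Qed.

Lemma sqnorm_berezin_coord h b :
  sqnorm (berezin T h b) = sqnorm (S (words_adj T b h)).
Proof. by rewrite -berezin_val. Qed.

Lemma berezin_linear a x y :
  berezin T (a *: x + y) = a *: berezin T x + berezin T y.
Proof.
apply/val_inj/funext => b; apply: val_inj.
rewrite [LHS]berezin_val words_adj_linear linearP -!berezin_val.
by [].
Qed.

Lemma berezin_contraction h : sqnorm (berezin T h) <= sqnorm h.
Proof.
rewrite -lee_fin sqnorm_l2E; apply: esum_le_seq => s us.
by under eq_bigr do rewrite sqnorm_berezin_coord; exact: sum_words_sqrt_le.
Qed.

Lemma berezin_adjP x (y : fock n (range_closure (defect T))) :
   inner (berezin T x) y = inner x (adj (berezin T) y).
Proof.
apply: (adjP (C := 1) (@hilbert_complete R H)); first exact: berezin_linear.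
by move=> z; rewrite mul1r; exact: berezin_contraction.
Qed.

Lemma Re_inner_fock_proj (E : innerProductType R) q (f : fock n E) :
  complex.Re (inner (fock_proj q f) f) = \sum_(t : twords n q) sqnorm (f (tword t)).
Proof.
pose F b := if [forall i, size (b i) == q i] then sqnorm (f b) else 0.
have F0 b : 0 <= F b by rewrite /F; case: ifP => // _; exact: sqnorm_ge0.
transitivity (rsum F).
  rewrite /inner/= /l2_inner /csum/=; congr rsum; apply/funext => b.
  by rewrite /F; case: ifP => //; rewrite inner0l.
apply: EFin_inj; rewrite rsum_ge0E//; last first.
  apply: rsummable_le (l2_rsummable f) => b; rewrite !ger0_norm ?sqnorm_ge0//.
  by rewrite /F; case: ifP => // _; exact: sqnorm_ge0.
rewrite (esum_finType (@tword_inj k n q))//.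
  congr (_%:E); apply: eq_bigr => t _; rewrite /F ifT//.
  by apply/forallP => i; rewrite size_tword.
by move=> b; rewrite /F; case: ifP => [/forallP/twordP//|]; rewrite eqxx.
Qed.

(** This finite sum is the numerator of the [q]-th term of the curvature, an
    a priori infinite trace. *)
Definition level_mass q : R :=
  \sum_(t : twords n q) \sum_s sqnorm (words_op T (tword t) (S (u s))).

(** The vector lies in the range of the defect, where [u] is a basis; moving the
    operators to the other side turns an infinite-dimensional expression into [r]
    coefficients of [x]. *)
Lemma sqnorm_sqrt_words b x : sqnorm (S (words_adj T b x)) =
  \sum_s sqmod (inner x (words_op T b (S (u s)))).
Proof.
have : range (defect T) (S (words_adj T b x)) by exact: (sqrt_op_range Tpos ou uT).
rewrite -uT => /lin_spanP[c /(parseval_finite ou) ->]; apply: eq_bigr => s _.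
rewrite (sqrt_op_symmetric Tpos ou uT) -[in LHS]sqmod_conj -inner_conj.
by rewrite -words_adjP// -sqmod_conj -inner_conj.
Qed.

(** The trace is a sum over an orthonormal basis of [H] of finite sums of squared
    coefficients; exchanging the sums, Parseval's identity evaluates each. *)
Lemma trace_berezin q :
  trace (adj (berezin T) \o fock_proj q \o berezin T) = (level_mass q)%:E.
Proof.
have oB := @get_orthonormal_basis R H; rewrite /trace; set B := get _ in oB *.
transitivity (\esum_(b in B) \sum_(t : twords n q) \sum_s
    (sqmod (inner b (words_op T (tword t) (S (u s)))))%:E)%E.
  apply: eq_esum => b _; rewrite -[inner _ _]conjCK Re_conj -inner_conj/=.
  rewrite -berezin_adjP inner_conj Re_conj Re_inner_fock_proj -sumEFin.
  apply: eq_bigr => t _; rewrite sqnorm_berezin_coord sqnorm_sqrt_words.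
  by rewrite -sumEFin.
rewrite esum_sum; last first.
  by move=> b t _ _; apply: sume_ge0 => s _; rewrite lee_fin sqmod_ge0.
rewrite /level_mass -sumEFin; apply: eq_bigr => t _.
rewrite esum_sum; last by move=> b s _ _; rewrite lee_fin sqmod_ge0.
rewrite -sumEFin; apply: eq_bigr => s _.
rewrite -(parseval _ (@hilbert_complete R H) oB); apply: eq_esum => b _.
by rewrite inner_conj sqmod_conj.
Qed.

End Berezin.

Section FockTrace.
Context {R : realType} {k : nat} {n : 'I_k -> nat}.
Local Notation scalars := (R[i]^o : innerProductType R).

Let delta_fun (w : words n) : words n -> R[i]^o := fun b => if b == w then 1 else 0.

Let delta_l2 w : delta_fun w \in square_summable (words n) scalars.
Proof.
rewrite inE (@esum_finType _ _ unit (fun=> w)) ?ltry//.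
- by move=> [] [].
- by move=> b; exact: sqnorm_ge0.
move=> b; rewrite /delta_fun; case: (b =P w) => [->|_]; first by exists tt.
by rewrite sqnorm0 eqxx.
Qed.

Let delta w : fock n scalars := L2 (delta_l2 w).

Let inner_delta (f : fock n scalars) w : inner f (delta w) = f w.
Proof.
rewrite /inner/= /l2_inner /csum/=.
rewrite [X in rsum X](_ : _ = fun b => if b == w then complex.Re (f w) else 0).
  rewrite [X in (_ +i* rsum X)%C]
    (_ : _ = fun b => if b == w then complex.Im (f w) else 0).
    by rewrite !rsum_single; case: (f w).
  apply/funext => b; rewrite /delta_fun /inner/= /scalar_inner.
  by case: eqP => [->|_]; rewrite ?rmorph1 ?mulr1 ?rmorph0 ?mulr0.
apply/funext => b; rewrite /delta_fun /inner/= /scalar_inner.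
by case: eqP => [->|_]; rewrite ?rmorph1 ?mulr1 ?rmorph0 ?mulr0.
Qed.

(** The projection is a sum of rank-one projections, one for each word of length
    [q], and each has trace [1] in any orthonormal basis by Parseval's identity in
    the complete space of square-summable families. *)
Lemma trace_fock_proj q :
  trace (fock_proj q : fock n scalars -> fock n scalars)
  = (\prod_(i < k) n i ^ q i)%N%:R%:E.
Proof.
have oB := @get_orthonormal_basis R (fock n scalars).
rewrite /trace; set B := get _ in oB *.
transitivity (\esum_(b in B) \sum_(t : twords n q)
    (sqmod (inner b (delta (tword t))))%:E)%E.
  apply: eq_esum => b _; rewrite Re_inner_fock_proj -sumEFin.
  by apply: eq_bigr => t _; rewrite inner_delta -Re_mul_conj.
rewrite esum_sum; last by move=> b t _ _; rewrite lee_fin sqmod_ge0.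
rewrite (eq_bigr (fun=> 1%:E)) => [|t _].
  by rewrite sumEFin sumr_const card_twords.
under eq_esum do rewrite inner_conj sqmod_conj.
rewrite (parseval _ (l2_complete (@sqmod_complete R)) oB) /sqnorm inner_delta.
by rewrite /= /delta_fun eqxx.
Qed.

End FockTrace.

(** * Limits over the lattice of multi-indices *)

Section MultiIndexLimits.
Context {R : realType} {k : nat}.
Implicit Types (p : 'I_k -> nat) (x a : ('I_k -> nat) -> R).

(** Adding the error term to [x p] gives an upper bound for [x q] at all later
    [q]; the limit is the infimum of these upper bounds, as the error vanishes
    along cofinal sequences. *)
Lemma cofinal_quasi_decreasing_cvg x (C : R) : 0 <= C -> (forall q, 0 <= x q) ->
  (forall p q, (forall i, (p i <= q i)%N) ->
    x q <= x p + C * \sum_(i < k) (2 ^+ p i)^-1) ->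
  exists l : R, forall q : nat -> 'I_k -> nat, cofinal_increasing q ->
    x (q m) @[m --> \oo] --> l.
Proof.
move=> C0 x0 xdec.
pose err p := C * \sum_(i < k) (2 ^+ p i)^-1.
have err0 p : 0 <= err p.
  by rewrite mulr_ge0// sumr_ge0// => i _; rewrite invr_ge0 exprn_ge0.
pose D := [set x p + err p | p in [set: 'I_k -> nat]].
have infD : has_inf D.
  split; first by exists (x (fun=> 0%N) + err (fun=> 0%N)), (fun=> 0%N).
  by exists 0 => _ [p _ <-]; rewrite addr_ge0.
exists (inf D) => q [qmono qcofinal]; apply/cvgrPdist_le => e e0.
have [_ [p _ <-] xp] := inf_adherent e0 infD.
have ke : 0 < e / (C * k%:R + 1).
  by rewrite divr_gt0// ltr_wpDl// mulr_ge0.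
have [N hN] := natSinv_lt ke.
have [M1 hM1] := qcofinal p; have [M2 hM2] := qcofinal (fun=> N).
exists (maxn M1 M2) => // m /=; rewrite geq_max => /andP[M1m M2m].
rewrite ler_distlC; apply/andP; split; last first.
  have pq i : (p i <= q m i)%N := leq_trans (hM1 i) (qmono _ _ i M1m).
  by have := xdec p (q m) pq; rewrite -/(err p); lra.
have : inf D <= x (q m) + err (q m) by apply: ge_inf; [exact: infD.2|exists (q m)].
suff : err (q m) <= e by lra.
have err_le : \sum_(i < k) (2 ^+ q m i)^-1 <= k%:R * (e / (C * k%:R + 1)).
  rewrite -[k in k%:R * _]card_ord mulr_natl -sumr_const; apply: ler_sum => i _.
  apply: le_trans (ltW (hN N (leqnn N))); rewrite lef_pV2 ?posrE ?exprn_gt0//.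
  rewrite -natrX ler_nat; apply: leq_trans (ltn_expl (q m i) (ltnSn 1)).
  by rewrite ltnS; exact: leq_trans (hM2 i) (qmono _ _ i M2m).
apply: le_trans (ler_wpM2l C0 err_le) _.
have -> : C * (k%:R * (e / (C * k%:R + 1))) = e * (C * k%:R / (C * k%:R + 1)).
  by rewrite !mulrA [e * C]mulrC -!mulrA [e * (k%:R * _)]mulrCA.
rewrite ler_piMr ?(ltW e0)//.
by rewrite ler_pdivrMr ?mul1r ?lerDl// ltr_wpDl// mulr_ge0.
Qed.

Definition simplex (m : nat) : {set {ffun 'I_k -> 'I_m.+1}} :=
  [set q : {ffun 'I_k -> 'I_m.+1} | (\sum_(i < k) q i <= m)%N].

Lemma card_simplex m : #|simplex m| = 'C(m + k, k).
Proof.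
rewrite addnC -card_partial_ord_partitions.
pose f (t : k.-tuple 'I_m.+1) : {ffun 'I_k -> 'I_m.+1} := [ffun i => tnth t i].
have f_inj : injective f.
  by move=> s t /ffunP st; apply: eq_from_tnth => i; have := st i; rewrite !ffunE.
rewrite -(card_imset _ f_inj); apply: eq_card => q; apply/idP/imsetP.
  rewrite inE => qm; exists [tuple q i | i < k]; last first.
    by apply/ffunP => i; rewrite ffunE tnth_mktuple.
  rewrite inE big_tuple; apply: leq_trans qm; apply: eq_leq; apply: eq_bigr => i _.
  by rewrite tnth_mktuple.
move=> [t]; rewrite !inE big_tuple => tm ->; apply: leq_trans tm; apply: eq_leq.
by apply: eq_bigr => i _; rewrite ffunE.
Qed.

(** Shifting all coordinates by [N] embeds a smaller simplex into the points
    with all coordinates at least [N]; hence few points of a large simplex lie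
    near its coordinate faces. *)
Lemma card_simplex_far N m : (k * N <= m)%N ->
  ('C(m - k * N + k, k) <=
    #|[set q in simplex m | [forall i, (N <= q i)%N]]|)%N.
Proof.
move=> Nm; rewrite -card_simplex.
pose f (q : {ffun 'I_k -> 'I_(m - k * N).+1}) : {ffun 'I_k -> 'I_m.+1} :=
  [ffun i => inord (q i + N)].
have fE (q : {ffun 'I_k -> 'I_(m - k * N).+1}) i : f q i = (q i + N)%N :> nat.
  rewrite ffunE inordK// ltnS -[leqRHS](subnK Nm).
  apply: leq_add; first by rewrite -ltnS.
  by apply: leq_pmull; exact: leq_ltn_trans (ltn_ord i).
have f_inj : injective f.
  move=> p q /ffunP pq; apply/ffunP => i; apply: val_inj.
  by have := congr1 val (pq i); rewrite /= !fE => /addIn.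
rewrite -(card_imset _ f_inj); apply/subset_leq_card/fintype.subsetP => _ /imsetP[q + ->].
rewrite !inE => qm; apply/andP; split; last by apply/forallP => i; rewrite fE leq_addl.
under eq_bigr do rewrite fE.
by rewrite big_split/= sum_nat_const card_ord -[leqRHS](subnK Nm) leq_add2r.
Qed.

(** Pascal's rule, iterated [K] times, with each increment bounded by the last. *)
Lemma bin_shift_le K m j :
  ('C(m + K + j.+1, j.+1) <= 'C(m + j.+1, j.+1) + K * 'C(m + K + j, j))%N.
Proof.
elim: K => [|K IHK]; first by rewrite addn0 mul0n addn0.
rewrite [(m + K.+1)%N]addnS !addSn binS mulSn.
apply: leq_trans (leq_add IHK (leqnn _)) _.
rewrite -addnA leq_add2l [leqRHS]addnC; apply: leq_add; last by rewrite addnS.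
by rewrite leq_mul2l leq_bin2l ?orbT.
Qed.

(** Almost all of a large simplex is far from its coordinate faces, where a
    decreasing family is close to its infimum. *)
Lemma simplex_average_cvg a : (0 < k)%N -> (forall q, 0 <= a q) ->
  (forall p q, (forall i, (p i <= q i)%N) -> a q <= a p) ->
  (fun m : nat => ('C(m + k, k)%:R)^-1 *
    \sum_(q : {ffun 'I_k -> 'I_m.+1} | (\sum_(i < k) q i <= m)%N)
      a (fun i => q i)) @ \oo --> inf (range a).
Proof.
move=> k0 a0 adec; pose L := inf (range a); pose c := a (fun=> 0%N).
have infa : has_inf (range a).
  split; first by exists c, (fun=> 0%N).
  by exists 0 => _ [q _ <-].
have La q : L <= a q by apply: ge_inf; [exact: infa.2|exists q].
apply/cvgrPdist_le => e e0.
have e2 : 0 < e / 2 by rewrite divr_gt0.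
have [_ [p _ <-] ap] := inf_adherent e2 infa.
pose N := (\max_i p i)%N; pose K := (k * N)%N.
have c0 : 0 <= c by exact: a0.
have ce : 0 < e / 2 / (c * (K * k)%:R + 1).
  by rewrite divr_gt0// ltr_wpDl// mulr_ge0.
have [M hM] := natSinv_lt ce.
exists (maxn K M) => // m /=; rewrite geq_max => /andP[Km Mm].
pose far (q : {ffun 'I_k -> 'I_m.+1}) := [forall i, (N <= q i)%N].
pose s := \sum_(q in simplex m) a (fun i => q i).
pose bad := #|[set q in simplex m | ~~ far q]|.
pose B := 'C(m + k, k).
have B0 : (0 : R) < B%:R by rewrite ltr0n bin_gt0 leq_addl.
have sE : \sum_(q : {ffun 'I_k -> 'I_m.+1} | (\sum_(i < k) q i <= m)%N)
    a (fun i => q i) = s by apply: eq_bigl => q; rewrite inE.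
rewrite sE -/B ler_distlC.
have s_ge : L * B%:R <= s.
  rewrite mulr_natr /B -card_simplex -sumr_const.
  by apply: ler_sum => q _; exact: La.
have s_le : s <= (L + e / 2) * B%:R + c * bad%:R.
  have -> : (L + e / 2) * B%:R + c * bad%:R =
      \sum_(q in simplex m) ((L + e / 2) + (if far q then 0 else c)).
    rewrite big_split/= sumr_const card_simplex mulr_natr; congr (_ + _).
    rewrite [RHS](eq_bigr (fun q => if ~~ far q then c else 0)); last first.
      by move=> q _; case: (far q).
    rewrite -big_mkcondr/= mulr_natr -sumr_const.
    by apply: eq_bigl => q; rewrite !inE.
  apply: ler_sum => q _; case: ifPn => [/forallP Nq|_].
    rewrite addr0; apply: le_trans (ltW ap); apply: adec => i.
    by apply: leq_trans (Nq i); exact: (leq_bigmax (F := p)).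
  have : a (fun i => q i) <= c by exact: adec.
  have := La p; move: ap; rewrite -/L.
  have : 0 <= L by apply: lb_le_inf; [exact: infa.1|move=> _ [? _ <-]].
  lra.
have bad_le : (bad * (m + k) <= K * k * B)%N.
  have far_ge := card_simplex_far Km; rewrite -/K in far_ge.
  have badE : (bad + #|[set q in simplex m | far q]| = B)%N.
    rewrite /B -card_simplex -(cardsID [set q | far q] (simplex m)) addnC.
    by congr (_ + _)%N; apply: eq_card => q; rewrite !inE// andbC.
  have shift := bin_shift_le K (m - K) k.-1; rewrite subnK// prednK// in shift.
  have diag := mul_bin_diag (m + k) k.-1; rewrite prednK// in diag.
  have mk : (m + k).-1 = (m + k.-1)%N by rewrite -(prednK k0) addnS.
  rewrite -mulnA -diag mulnCA mk mulnC leq_mul2l; apply/orP; right.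
  rewrite -(leq_add2r 'C(m - K + k, k)) [leqRHS]addnC.
  by apply: leq_trans shift; rewrite -/B -badE leq_add2l.
apply/andP; split.
  rewrite (@le_trans _ _ L)// ?gerBl ?(ltW e0)//.
  by rewrite mulrC ler_pdivlMr.
rewrite mulrC ler_pdivrMr//; apply: le_trans s_le _.
suff : c * bad%:R <= e / 2 * B%:R by lra.
have mk0 : (0 : R) < (m + k)%:R by rewrite ltr0n addn_gt0 k0 orbT.
rewrite -(ler_pM2r mk0); have -> : c * bad%:R * (m + k)%:R = c * (bad * (m + k))%:R.
  by rewrite natrM mulrA.
apply: le_trans (_ : c * (K * k)%:R * B%:R <= _).
  by rewrite -mulrA ler_wpM2l// -natrM ler_nat.
rewrite [leRHS]mulrAC ler_pM2r//.
have := hM (m + k.-1)%N (leq_trans Mm (leq_addr _ _)).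
rewrite -addnS prednK// => h.
have d0 : 0 < c * (K * k)%:R + 1 by rewrite ltr_wpDl// mulr_ge0.
move: h; rewrite ltr_pdivlMr// mulrC ltr_pdivrMr// => h.
by apply: le_trans _ (ltW h); rewrite lerDl.
Qed.

End MultiIndexLimits.

(** * Level masses, dimensions, and the comparison *)

Section SplitWords.
Context {k : nat} {n : 'I_k -> nat} {p q : 'I_k -> nat}.
Hypothesis pq : forall i, (p i <= q i)%N.
Let d i := (q i - p i)%N.

Lemma split_twords : exists2 phi : twords n q -> twords n d * twords n p,
  injective phi &
  forall t, tword t = fun i => tword (phi t).1 i ++ tword (phi t).2 i.
Proof.
have /choice[phi phiP] (t : twords n q) : exists ac : twords n d * twords n p,
    tword t = fun i => tword ac.1 i ++ tword ac.2 i.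
  have [|a aE] := @twordP k n d (fun i => take (d i) (tword t i)).
    by move=> i; rewrite size_takel// size_tword leq_subr.
  have [|c cE] := @twordP k n p (fun i => drop (d i) (tword t i)).
    by move=> i; rewrite size_drop size_tword /d subKn.
  exists (a, c); rewrite /= aE cE; apply: functional_extensionality_dep => i.
  by rewrite cat_take_drop.
exists phi => // s t st; apply: tword_inj.
by rewrite (phiP s) (phiP t) st.
Qed.

Lemma split_bword (f : bwords n q) : (forall i, (d i <= size (bword f i))%N) ->
  exists (a : twords n d) (c : bwords n p),
    bword f = fun i => tword a i ++ bword c i.
Proof.
move=> df; have [|a aE] := @twordP k n d (fun i => take (d i) (bword f i)).
  by move=> i; rewrite size_takel.
have [|c cE] := @bwordP k n p (fun i => drop (d i) (bword f i)).
  move=> i; rewrite size_drop leq_subLR /d subnK//; exact: size_bword.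
exists a, c; rewrite aE cE; apply: functional_extensionality_dep => i.
by rewrite cat_take_drop.
Qed.

Definition long_words : {set bwords n q} :=
  [set f | [forall i, (d i <= size (bword f i))%N]].

Lemma card_long_words : (#|twords n d| * #|bwords n p| <= #|long_words|)%N.
Proof.
have /choice[phi phiP] (ac : twords n d * bwords n p) : exists f : bwords n q,
    bword f = fun i => tword ac.1 i ++ bword ac.2 i.
  apply: bwordP => i; rewrite size_cat size_tword /d.
  by rewrite -leq_subRL ?leq_subr// subKn// size_bword.
rewrite -card_prod -(card_imset predT (f := phi)).
  apply/subset_leq_card/fintype.subsetP => _ /imsetP[ac _ ->].
  rewrite inE; apply/forallP => i.
  by rewrite phiP size_cat size_tword leq_addr.
move=> [a c] [a' c'] acE; have := phiP (a, c); rewrite acE phiP /= => E.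
have eqi i : tword a i = tword a' i /\ bword c i = bword c' i.
  have /eqP := congr1 (fun b : words n => b i) E.
  by rewrite eqseq_cat ?size_tword// => /andP[/eqP-> /eqP->].
congr (_, _); [apply: tword_inj|apply: bword_inj];
  by apply: functional_extensionality_dep => i; have [] := eqi i.
Qed.

End SplitWords.

Section Masses.
Context {R : realType} {H : hilbertType R} {k : nat} {n : 'I_k -> nat}.
Variable T : forall i : 'I_k, 'I_(n i) -> {linear H -> H}.
Hypothesis T_polyball : regular_polyball T.
Hypothesis n_ge2 : forall i, (2 <= n i)%N.
Context {r : nat} {u : 'I_r -> H}.
Hypotheses (ou : orthonormal u) (uT : lin_span (range u) = range (defect T)).
Implicit Types (p q : 'I_k -> nat).

Local Notation S := (sqrt_op (defect T)).
Local Notation mass b := (\sum_s sqnorm (words_op T b (S (u s)))).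
Let Tpos := defect_positive T_polyball.

Let mass_ge0 b : 0 <= mass b.
Proof. by apply: sumr_ge0 => s _; exact: sqnorm_ge0. Qed.

Lemma card_twords_gt0 q : (0 : R) < #|twords n q|%:R.
Proof.
rewrite ltr0n card_twords prodn_gt0// => i.
by rewrite expn_gt0 (ltn_trans _ (n_ge2 i)).
Qed.

Lemma curvature_termE q :
  curvature_term T q = level_mass T (u := u) q / #|twords n q|%:R.
Proof.
by rewrite /curvature_term (trace_berezin T_polyball ou uT) trace_fock_proj card_twords.
Qed.

Lemma curvature_term_ge0 q : 0 <= curvature_term T q.
Proof.
rewrite curvature_termE divr_ge0// ?(ltW (card_twords_gt0 q))//.
by apply: sumr_ge0 => t _; exact: mass_ge0.
Qed.

(** The letters are contractions and a longer word is a shorter one preceded by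
    further letters. *)
Lemma curvature_term_decreasing p q : (forall i, (p i <= q i)%N) ->
  curvature_term T q <= curvature_term T p.
Proof.
move=> pq; have [phi phi_inj phiP] := @split_twords k n p q pq.
rewrite !curvature_termE ler_pdivrMr ?card_twords_gt0// mulrAC.
rewrite ler_pdivlMr ?card_twords_gt0//.
have cardq : #|twords n q| = (#|twords n (fun i => q i - p i)%N| * #|twords n p|)%N.
  rewrite !card_twords -big_split/=; apply: eq_bigr => i _.
  by rewrite -expnD subnK.
rewrite cardq natrM mulrA ler_pM2r ?card_twords_gt0// mulrC.
pose G (ac : twords n (fun i => q i - p i)%N * twords n p) := mass (tword ac.2).
apply: (@le_trans _ _ (\sum_ac G ac)).
  apply: le_trans (ler_sum_inj phi_inj (fun ac => mass_ge0 (tword ac.2))).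
  apply: ler_sum => t _; apply: ler_sum => s _.
  by rewrite phiP words_op_cat// words_op_contraction.
rewrite -(pair_bigA _ (fun a c => G (a, c)))/=.
rewrite (eq_bigr (fun=> level_mass T (u := u) p)) => [|a _ //].
by rewrite sumr_const mulr_natl.
Qed.

Lemma level_mass_ge q : inf (range (curvature_term T)) * #|twords n q|%:R <=
  level_mass T (u := u) q.
Proof.
rewrite -ler_pdivlMr ?card_twords_gt0// -curvature_termE.
apply: ge_inf; last by exists q.
by exists 0 => _ [p _ <-]; exact: curvature_term_ge0.
Qed.

(** The words are grouped according to their lengths, and [level_mass_ge] is
    applied to each group. *)
Lemma bounded_mass_ge m : inf (range (curvature_term T)) *
  #|bwords n (fun=> m)|%:R <= \sum_(f : bwords n (fun=> m)) mass (bword f).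
Proof.
pose L := inf (range (curvature_term T)); rewrite -/L.
pose sz (f : bwords n (fun=> m)) : {ffun 'I_k -> 'I_m.+1} :=
  [ffun i => inord (size (bword f i))].
have szE f i : sz f i = size (bword f i) :> nat.
  by rewrite ffunE inordK// ltnS; exact: size_bword.
rewrite (partition_big sz xpredT)//= card_bwords.
rewrite (bigA_distr_bigA (fun i (j : 'I_m.+1) => n i ^ j)%N) natr_sum mulr_sumr.
apply: ler_sum => pi _; pose p i := pi i : nat.
rewrite -card_twords; apply: le_trans (level_mass_ge p) _.
have /choice[e eP] (t : twords n p) : exists f : bwords n (fun=> m), bword f = tword t.
  by apply: bwordP => i; rewrite size_tword -ltnS /p.
have e_inj : injective e by move=> s t st; apply: tword_inj; rewrite -!eP st.
rewrite [leRHS]big_mkcond/= /level_mass.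
apply: le_trans (ler_sum_inj e_inj
  (F := fun f => if sz f == pi then mass (bword f) else 0) _).
  apply: ler_sum => t _; rewrite eP ifT//; apply/eqP/ffunP => i.
  by apply: val_inj; rewrite /= szE eP size_tword.
by move=> f; case: ifP.
Qed.

Lemma MspaceE q : Mspace T q =
  lin_span (range (fun x : bwords n q * 'I_r => words_op T (bword x.1) (u x.2))).
Proof.
apply/seteqP; split; apply: lin_span_min.
  move=> _ [b [h [bq ->]]]; have [f <-] := bwordP bq.
  have : range (defect T) (defect T h) by exists h.
  rewrite -uT => /lin_spanP[c ->]; rewrite -/(words_op T (bword f) _) words_op_sum//.
  apply: lin_span_sum => s _; apply: lin_span_sub; exists (f, s) => //.
move=> _ [[f s] _ <-]; apply: lin_span_sub.
have [h _ hE] : range (defect T) (u s) by rewrite -uT; apply: lin_span_sub; exists s.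
exists (bword f), h; split; first exact: size_bword.
by rewrite hE.
Qed.

(** In an orthonormal basis [y] of the space, the left-hand side is the sum over
    [t] of the part of [||K y_t||^2] carried by bounded words, [K] being the
    Berezin kernel; each of these is at most [1] as [K] is a contraction. *)
Lemma bounded_mass_le_dim m :
  \sum_(f : bwords n (fun=> m)) mass (bword f) <=
  (Defs.dim (Mspace T (fun=> m)))%:R.
Proof.
rewrite MspaceE; set w := fun x : _ * _ => _.
have [y [oy yw]] := orthonormal_span w.
have massE b : (forall s, lin_span (range w) (words_op T b (S (u s)))) ->
    mass b = \sum_t sqnorm (S (words_adj T b (y t))).
  move=> bw; under eq_bigr => s _.
    have := bw s; rewrite -yw => /lin_spanP[c /(parseval_finite oy) ->].
    over.
  rewrite exchange_big; apply: eq_bigr => t _.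
  rewrite (sqnorm_sqrt_words T_polyball ou uT); apply: eq_bigr => s _.
  by rewrite inner_conj sqmod_conj.
rewrite (eq_bigr (fun f : bwords n (fun=> m) =>
    \sum_t sqnorm (S (words_adj T (bword f) (y t))))); last first.
  move=> f _; apply: massE => s.
  have : range (defect T) (S (u s)) by exact: sqrt_op_range Tpos ou uT _.
  rewrite -uT => /lin_spanP[c ->]; rewrite words_op_sum//.
  by apply: lin_span_sum => s' _; apply: lin_span_sub; exists (f, s').
rewrite exchange_big/= -[leRHS]mulr1n.
apply: (@le_trans _ _ (\sum_(t < Defs.dim (lin_span (range w))) 1)); last first.
  by rewrite sumr_const card_ord.
apply: ler_sum => t _; under eq_bigr do rewrite (sqnorm_sqrt_defect T_polyball ou uT).
have := sum_defect_words_le T_polyball m (y t).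
by rewrite /sqnorm oy eqxx.
Qed.

Lemma dim_Mspace_le q : (Defs.dim (Mspace T q) <= #|bwords n q| * r)%N.
Proof.
by rewrite MspaceE; apply: leq_trans (dim_span_le _) _; rewrite card_prod card_ord.
Qed.

(** A long word is a word of length [q - p] followed by one of length at most
    [p], so its vectors lie in the image of the smaller space under one of finitely
    many operators; the other words are only counted. *)
Lemma dim_Mspace_split p q : (forall i, (p i <= q i)%N) ->
  (Defs.dim (Mspace T q) <=
     #|twords n (fun i => q i - p i)| * Defs.dim (Mspace T p) +
     (#|bwords n q| - #|twords n (fun i => q i - p i)| * #|bwords n p|) * r)%N.
Proof.
move=> pq; pose d i := (q i - p i)%N; rewrite -/d !MspaceE.
set wq := fun x : bwords n q * 'I_r => _; set wp := fun x : bwords n p * 'I_r => _.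
have [y [oy yw]] := orthonormal_span wp.
pose short := {f : bwords n q | f \notin @long_words k n p q}.
pose v (x : twords n d * 'I_(Defs.dim (lin_span (range wp))) + short * 'I_r) :=
  match x with
  | inl (a, t) => words_op T (tword a) (y t)
  | inr (f, s) => words_op T (bword (val f)) (u s)
  end.
have [z [oz zw]] := orthonormal_span wq.
have : (Defs.dim (lin_span (range wq)) <=
    #|{: twords n d * 'I_(Defs.dim (lin_span (range wp))) + short * 'I_r}|)%N.
  apply: (steinitz (w := v) (orthonormal_lin_indep oz)) => i.
  suff : lin_span (range wq) `<=` lin_span (range v).
    by apply; rewrite -zw; apply: lin_span_sub; exists i.
  apply: lin_span_min => _ [[f s] _ <-].
  have [fl|fs] := boolP (f \in @long_words k n p q); last first.
    by apply: lin_span_sub; exists (inr (exist _ f fs, s)).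
  have [|a [c fE]] := @split_bword k n p q pq f.
    by move=> i'; move: fl; rewrite inE => /forallP.
  rewrite /wq/= fE words_op_cat//.
  have : lin_span (range y) (words_op T (bword c) (u s)).
    by rewrite yw; apply: lin_span_sub; exists (c, s).
  move=> /lin_spanP[e ->]; rewrite words_op_sum//.
  by apply: lin_span_sum => t _; apply: lin_span_sub; exists (inl (a, t)).
rewrite card_sum !card_prod !card_ord => /leq_trans; apply.
rewrite leq_add2l leq_mul2r; apply/orP; right.
have -> : #|{: short}| = #|~: @long_words k n p q|.
  by rewrite card_sig; apply: eq_card => f; rewrite !inE.
by rewrite cardsCs finset.setCK leq_sub2l// card_long_words.
Qed.

End Masses.

Section EulerRatio.
Context {R : realType} {H : hilbertType R} {k : nat} {n : 'I_k -> nat}.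
Variable T : forall i : 'I_k, 'I_(n i) -> {linear H -> H}.
Hypothesis T_polyball : regular_polyball T.
Hypothesis n_ge2 : forall i, (2 <= n i)%N.
Context {r : nat} {u : 'I_r -> H}.
Hypotheses (ou : orthonormal u) (uT : lin_span (range u) = range (defect T)).
Implicit Types (p q : 'I_k -> nat).

Lemma euler_ratioE q :
  euler_ratio T q = (Defs.dim (Mspace T q))%:R / #|bwords n q|%:R :> R.
Proof. by rewrite /euler_ratio card_bwords. Qed.

Lemma card_bwords_gt0 q : (0 : R) < #|bwords n q|%:R.
Proof. by rewrite ltr0n card_bwords prodn_gt0// => i; rewrite big_ord_recl. Qed.

Lemma euler_ratio_ge0 q : 0 <= euler_ratio T q :> R.
Proof. by rewrite euler_ratioE divr_ge0. Qed.

Lemma euler_ratio_le q : euler_ratio T q <= r%:R :> R.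
Proof.
rewrite euler_ratioE ler_pdivrMr ?card_bwords_gt0// -natrM mulnC ler_nat.
exact: dim_Mspace_le uT _.
Qed.

Lemma geometric_sum_le m l : (2 <= m)%N -> (\sum_(j < l) m ^ j <= m ^ l)%N.
Proof.
move=> m2; elim: l => [|l IHl]; first by rewrite big_ord0.
rewrite big_ord_recr expnS /=; apply: leq_trans (leq_add IHl (leqnn _)) _.
by rewrite addnn -mul2n leq_mul2r m2 orbT.
Qed.

(** A word of length at most [q] either has length at least [q - p], or is one of
    a proportion of at most [2 ^ - p] of all words. *)
Lemma short_words_proportion m (p q : nat) : (2 <= m)%N -> (p <= q)%N ->
  1 - (m ^ (q - p) * \sum_(j < p.+1) m ^ j)%:R / (\sum_(j < q.+1) m ^ j)%:R
    <= (2 ^+ p)^-1 :> R.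
Proof.
move=> m2 pq; set A := (\sum_(j < q.+1) m ^ j)%N.
have m0 : (0 < m)%N by exact: ltn_trans m2.
have A0 : (0 : R) < A%:R by rewrite ltr0n /A big_ord_recl.
have AE : A = (\sum_(j < q - p) m ^ j + m ^ (q - p) * \sum_(j < p.+1) m ^ j)%N.
  rewrite /A -[q.+1](subnK (leqW pq)) subSn// addSnnS big_split_ord/=.
  by rewrite big_distrr/=; congr (_ + _)%N; apply: eq_bigr => j _; rewrite expnD.
rewrite lerBlDr -lerBlDl ler_pdivlMr// mulrBl mul1r lerBlDl -lerBlDr.
have mqA : (m ^ (q - p) * 2 ^ p <= A)%N.
  apply: (@leq_trans (m ^ q)).
    rewrite -[in leqRHS](subnK pq) expnD leq_mul2l; apply/orP; right.
    by case: (p) => // j; rewrite leq_exp2r.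
  by rewrite /A big_ord_recr/= leq_addl.
rewrite {1}AE natrD addrK mulrC ler_pdivlMr ?exprn_gt0// -natrX -natrM ler_nat.
apply: leq_trans mqA; rewrite leq_mul2r; apply/orP; right.
exact: geometric_sum_le.
Qed.

Lemma one_sub_prod_le (m : nat) (x : 'I_m -> R) : (forall i, 0 <= x i <= 1) ->
  1 - \prod_(i < m) x i <= \sum_(i < m) (1 - x i).
Proof.
elim: m x => [|m IHm] x x01; first by rewrite !big_ord0 subrr.
rewrite !big_ord_recl; set P := \prod_(i < m) _; set Q := \sum_(i < m) _.
have h : 1 - P <= Q by apply: IHm => i.
have /andP[x0 x1] := x01 ord0.
have : 0 <= (1 - x ord0) * (1 - P).
  rewrite mulr_ge0 ?subr_ge0//; apply: prodr_ile1 => i _; exact: x01.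
lra.
Qed.

Lemma euler_ratio_quasi_decreasing p q : (forall i, (p i <= q i)%N) ->
  euler_ratio T q <= euler_ratio T p + r%:R * \sum_(i < k) (2 ^+ p i)^-1 :> R.
Proof.
move=> pq; pose d i := (q i - p i)%N.
pose lam : R := (#|twords n d| * #|bwords n p|)%:R / #|bwords n q|%:R.
have Nq := card_bwords_gt0 q; have Np := card_bwords_gt0 p.
have card_le : (#|twords n d| * #|bwords n p| <= #|bwords n q|)%N.
  exact: leq_trans (card_long_words (n := n) pq) (max_card _).
have lam01 : 0 <= lam <= 1.
  rewrite divr_ge0//= ler_pdivrMr// mul1r ler_nat; exact: card_le.
apply: (@le_trans _ _ (euler_ratio T p + r%:R * (1 - lam))).
  apply: (@le_trans _ _ (lam * euler_ratio T p + r%:R * (1 - lam))).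
    rewrite !euler_ratioE ler_pdivrMr// mulrDl.
    have -> : lam * ((Defs.dim (Mspace T p))%:R / #|bwords n p|%:R) * #|bwords n q|%:R
        = (#|twords n d| * Defs.dim (Mspace T p))%:R.
      rewrite /lam !natrM; field; by rewrite !lt0r_neq0.
    have -> : r%:R * (1 - lam) * #|bwords n q|%:R =
        ((#|bwords n q| - #|twords n d| * #|bwords n p|) * r)%:R.
      rewrite natrM natrB// /lam; field; by rewrite lt0r_neq0.
    rewrite -natrD ler_nat.
    exact (dim_Mspace_split T_polyball uT pq).
  rewrite lerD2r ler_piMl ?euler_ratio_ge0//; by case/andP: lam01.
rewrite lerD2l ler_wpM2l//.
pose x i : R := (n i ^ d i * \sum_(j < (p i).+1) n i ^ j)%:R /
  (\sum_(j < (q i).+1) n i ^ j)%:R.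
have lamE : lam = \prod_(i < k) x i.
  rewrite /lam !card_bwords card_twords -big_split/= prodf_div !natr_prod.
  by [].
have x_ge0 i : 0 <= x i by rewrite divr_ge0.
rewrite lamE; apply: le_trans (one_sub_prod_le _) _.
  move=> i; rewrite x_ge0/= /x ler_pdivrMr ?mul1r ?ler_nat; last first.
    by rewrite ltr0n big_ord_recl.
  rewrite -[in leqRHS](subnK (leqW (pq i))) subSn// addSnnS big_split_ord/=.
  rewrite big_distrr/= -/(d i); apply: leq_trans (leq_addl _ _).
  by apply: leq_sum => j _; rewrite expnD.
by apply: ler_sum => i _; exact: short_words_proportion.
Qed.

Lemma euler_char_cvg (q : nat -> 'I_k -> nat) : cofinal_increasing q ->
  euler_ratio T (q m) @[m --> \oo] --> (euler_char T : R).
Proof.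
have [l lP] := cofinal_quasi_decreasing_cvg (ler0n R r) euler_ratio_ge0
  euler_ratio_quasi_decreasing.
rewrite /euler_char; move: q.
exact: (@getPex _ [set x : R | forall q : nat -> 'I_k -> nat,
  cofinal_increasing q -> euler_ratio T (q m) @[m --> \oo] --> x]
  (ex_intro _ l lP)).
Qed.

Lemma constant_cofinal : @cofinal_increasing k (fun m => fun=> m).
Proof.
split=> // p; exists (\max_i p i)%N => i.
exact: (leq_bigmax (F := p)).
Qed.

(** Weighing all words of length at most [m]: their mass is at least the
    curvature per word, and at most the dimension. *)
Lemma curvature_le_euler_ratio m :
  inf (range (curvature_term T)) <= euler_ratio T (fun=> m) :> R.
Proof.
rewrite euler_ratioE ler_pdivlMr ?card_bwords_gt0//.
apply: le_trans (bounded_mass_ge T_polyball n_ge2 ou uT m) _.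
by have := bounded_mass_le_dim T_polyball ou uT m.
Qed.

End EulerRatio.

Lemma finite_rank_orthonormal (R : realType) (V : lmodType R[i])
    (W : innerProductType R) (A : {linear V -> W}) : finite_rank A ->
  exists u : 'I_(Defs.rank A) -> W,
    orthonormal u /\ lin_span (range u) = range A.
Proof.
move=> [m [v [_ vA]]]; have [m' [u [ou uv]]] := gram_schmidt v.
rewrite vA in uv; have := orthonormal_has_dim ou; rewrite uv => /dimE d.
by rewrite /Defs.rank d; exists u.
Qed.

Theorem corollary1p3 (R : realType) (H : hilbertType R) (k : nat)
    (n : 'I_k -> nat) (T : forall i : 'I_k, 'I_(n i) -> {linear H -> H})
    (k_gt0 : (0 < k)%N) (n_ge2 : forall i, (2 <= n i)%N)
    (T_polyball : regular_polyball T) (T_finite_rank : finite_rank (defect T)) :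
  0 <= curvature T <= euler_char T /\ euler_char T <= (rank (defect T))%:R.
Proof.
have [u [ou uT]] := finite_rank_orthonormal T_finite_rank.
have term_ge0 := curvature_term_ge0 T_polyball ou uT.
have curvE : curvature T = inf (range (curvature_term T)).
  apply: cvg_lim => //; apply: simplex_average_cvg => //.
  exact (curvature_term_decreasing T_polyball n_ge2 ou uT).
have chi_cvg := euler_char_cvg T_polyball n_ge2 uT (constant_cofinal (k := k)).
rewrite -(cvg_lim (@Rhausdorff R) chi_cvg) curvE; split; last first.
  apply: limr_le; first by apply/cvg_ex; exists (euler_char T).
  by apply: nearW => m; exact: euler_ratio_le uT _.
apply/andP; split.
  apply: lb_le_inf; last by move=> _ [q _ <-].
  by exists (curvature_term T (fun=> 0%N)), (fun=> 0%N).
apply: limr_ge; first by apply/cvg_ex; exists (euler_char T).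
by apply: nearW => m; exact (curvature_le_euler_ratio T_polyball n_ge2 ou uT m).
Qed.
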